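(* Let $W=\max_{i\in[M]}|G_i|/\min_{i\in[M]}|G_i|$. There exist absolute constants $C,c_0,c_0',c_1,c_2>0$ such that if $p\ge c_0n\log(n+W)$ and $\log(M)\le c_0'\min_{i\in[M]}|G_i|$, then for every $\lambda>0$ there is an event of probability at least $1-Me^{-c_1n}$ on which $$\|\hat h_\lambda-h^*\|_2^2\le C\Big(W\frac{\|\xi\|_2^2}{n}+\|h^*\|_{\mathrm{GL}}^2\,\frac{\max_{i\in[M]}|G_i|}{n}+\lambda\|h^*\|_{\mathrm{GL}}\Big).$$ Moreover, if $s\max_{i\in[M]}|G_i|\le c_2n$, then on the same event $$\|\hat h_\lambda-h^*\|_2^2\le C\Big(W\frac{\|\xi\|_2^2}{n}+s\lambda^2\Big).$$
   Context: $[M]=\{1,\dots,M\}$, and $G_1,\dots,G_M$ is a prescribed partition of $\{1,\dots,p\}$ into $M$ disjoint (non-empty) groups. For $h\in\mathbb R^p$ and $S\subset\{1,\dots,p\}$, $h_S$ is the projection of $h$ onto the span of the canonical basis vectors $e_i$, $i\in S$. The group Lasso norm is $\|h\|_{\mathrm{GL}}=\sum_{i=1}^M\|h_{G_i}\|_2$. Data: $Y_i=\langle X_i,h^*\rangle+\xi_i$, $i=1,\dots,n$, where $X_1,\dots,X_n$ are i.i.d. $\mathcal N(0,I_p)$, $h^*\in\mathbb R^p$ is $s$-group sparse with respect to the partition, i.e. there is $I\subset[M]$ with $|I|\le s$ and $\sum_{i=1}^M\|h^*_{G_i}\|_2=\sum_{i\in I}\|h^*_{G_i}\|_2$, and $\xi=(\xi_1,\dots,\xi_n)$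 is an arbitrary error vector (deterministic, random, or depending adversarially on the $X_i$ and $h^*$). For $\lambda>0$, the group Lasso estimator $\hat h_\lambda$ is a minimizer over $h\in\mathbb R^p$ of $\frac1n\sum_{i=1}^n(Y_i-\langle X_i,h\rangle)^2+2\lambda\|h\|_{\mathrm{GL}}$. *)

(* Defs.v *)
From HB Require Import structures.
From mathcomp Require Export all_boot all_order all_algebra.
From mathcomp Require Export all_classical all_reals all_analysis.

Set Implicit Arguments.
Unset Strict Implicit.
Unset Printing Implicit Defensive.

Import Order.TTheory GRing.Theory Num.Theory.
Import numFieldNormedType.Exports.

Local Open Scope classical_set_scope.
Local Open Scope ring_scope.

(* The norm `|v| of the library on row vectors is the max norm. *)
Definition dot {R : realType} {m : nat} (u v : 'rV[R]_m) : R :=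
  \sum_(j < m) u ord0 j * v ord0 j.

Definition norm2 {R : realType} {m : nat} (v : 'rV[R]_m) : R :=
  Num.sqrt (dot v v).

Definition proj_on {R : realType} {p : nat} (S : {set 'I_p}) (h : 'rV[R]_p) :
    'rV[R]_p :=
  \row_j (if j \in S then h ord0 j else 0).

(* Injectivity is part of disjointness: the image set forgets repetitions.
   Non-emptiness of the groups is part of [finset.partition]. *)
Definition is_group_partition {p M : nat} (G : 'I_M -> {set 'I_p}) : Prop :=
  injective G /\ finset.partition [set G i | i in 'I_M]%SET [set: 'I_p]%SET.

Definition max_group {p M : nat} (G : 'I_M -> {set 'I_p}) : nat :=
  \max_(i < M) #|G i|.

(* Each #|G i| is at most p, so for 0 < M the default value p does not affect
   the minimum. *)
Definition min_group {p M : nat} (G : 'I_M -> {set 'I_p}) : nat :=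
  \big[minn/p]_(i < M) #|G i|.

Definition group_ratio (R : realType) {p M : nat} (G : 'I_M -> {set 'I_p}) : R :=
  (max_group G)%:R / (min_group G)%:R.

Definition gl_norm {R : realType} {p M : nat} (G : 'I_M -> {set 'I_p})
    (h : 'rV[R]_p) : R :=
  \sum_(i < M) norm2 (proj_on (G i) h).

Definition group_sparse {R : realType} {p M : nat} (G : 'I_M -> {set 'I_p})
    (s : nat) (h : 'rV[R]_p) : Prop :=
  exists I : {set 'I_M}, (#|I| <= s)%N /\
    \sum_(i < M) norm2 (proj_on (G i) h) =
    \sum_(i in I) norm2 (proj_on (G i) h).

Definition gl_objective {R : realType} {n p M : nat} (G : 'I_M -> {set 'I_p})
    (x : 'I_n -> 'rV[R]_p) (y : 'I_n -> R) (lambda : R) (h : 'rV[R]_p) : R :=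
  n%:R^-1 * \sum_(i < n) (y i - dot (x i) h) ^+ 2 + 2 * lambda * gl_norm G h.

Definition is_group_lasso {R : realType} {n p M : nat}
    (G : 'I_M -> {set 'I_p}) (x : 'I_n -> 'rV[R]_p) (y : 'I_n -> R)
    (lambda : R) (hhat : 'rV[R]_p) : Prop :=
  forall h, gl_objective G x y lambda hhat <= gl_objective G x y lambda h.

(* Random vectors of R^p take values in p.-tuple R, which carries the product
   Borel sigma-algebra in the library; this is the same point as a row vector. *)
Definition row_of_tuple {R : realType} {p : nat} (x : p.-tuple R) : 'rV[R]_p :=
  \row_j tnth x j.

(* N(0, I_p) is the product of p copies of N(0, 1); a product measure is
   determined by its values on measurable boxes. *)
Definition std_gaussian {R : realType} {p : nat}
    (mu : probability (p.-tuple R) R) : Prop :=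
  forall B : 'I_p -> set R, (forall j, measurable (B j)) ->
    mu [set x | forall j, B j (tnth x j)] =
    (\prod_(j < p) normal_prob (0 : R) 1 (B j))%E.

Definition mutually_independent {R : realType} {d d' : measure_display}
    {T : measurableType d} {T' : measurableType d'} (P : probability T R)
    {n : nat} (X : 'I_n -> {RV P >-> T'}) : Prop :=
  forall (J : {set 'I_n}) (B : 'I_n -> set T'),
    (forall i, measurable (B i)) ->
    P (\bigcap_(i in [set` J]) (X i @^-1` B i)) =
    (\prod_(i in J) P (X i @^-1` B i))%E.

Definition iid_std_gaussian {R : realType} {d : measure_display}
    {T : measurableType d} (P : probability T R) {n p : nat}
    (X : 'I_n -> {RV P >-> p.-tuple R}) : Prop :=
  mutually_independent X /\ forall i, std_gaussian (distribution P (X i)).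

(* Main.v *)
(* The residual r of a minimizer satisfies the optimality conditions
   <r, X h> <= n lambda |h|_GL for all h, with equality at the minimizer.
   If the dual norm of X^T v is at least c sqrt(min |G_i|) |v| for all v, they
   bound |r|, and then give |hhat|_GL <= |h*|_GL + C |xi| / sqrt(min |G_i|).
   Together with the restricted lower isometry
     |X h|^2 / n >= |h|^2 / 64 - C (max |G_i| / n) |h|_GL^2
   and the basic inequality, this yields both error bounds.

   The dual lower bound comes from a net of the sphere of R^n: if it failed at
   v, then |X^T v|^2 <= p |v|^2 / 16, a chi-square lower deviation with p degrees
   of freedom, which beats the cardinality of the net as p >= c0 n log(n + W).
   The lower isometry is proved by nets on unions of about n / max |G_i| groups,
   and extended to all h by Maurey's sampling argument.

   All tail bounds use only exponential moments of linear forms in the entries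
   of X: for the chi-square lower tail, exp(- x^2 / 2) is dominated by a linear
   combination of exponentials exp(s x) whose Gaussian mean is less than 1. *)
Require Import Defs.
From mathcomp Require Import measurable_realfun ring lra zify.
Import Order.TTheory GRing.Theory Num.Theory.
Import numFieldNormedType.Exports.
Import HBNNSimple.
Local Open Scope classical_set_scope.
Local Open Scope ring_scope.

Set Implicit Arguments.
Unset Strict Implicit.
Unset Printing Implicit Defensive.

(** The dual norm of X^T v is the largest norm among its blocks, so its lower bound asks for one
    good block. Since the group sizes add up to p, the bound |X^T v|^2 >= p |v|^2 / 16 on the whole
    vector provides one by pigeonhole. The obstacle is passing from the net to all v. Moving v
    perturbs a block by the operator norm of X on a group, of order sqrt(n + max |G_i|), while the
    target is only sqrt(min |G_i|). The ratio of the two is at most of order n + W. This forces a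
    mesh of order 1 / (n + W), hence a net of size (C (n + W))^n, and explains the logarithm in the
    condition on p. The condition on log M keeps the choice of k groups, M^k possibilities, below
    exp(k max |G_i|), which is the order of a net on their union. The exceptional set is defined by
    X alone. Off it the analysis is deterministic and covers all noise vectors, all sparse signals
    and all lambda at once, which is what allows adversarial noise. *)

(** * Euclidean geometry and group norms *)

Section Euclidean.
Context {R : realType} {m : nat}.
Implicit Types (u v w : 'rV[R]_m) (a : R).

Lemma dotC u v : dot u v = dot v u.
Proof. by apply: eq_bigr => j _; rewrite mulrC. Qed.

Lemma dotDl u v w : dot (u + v) w = dot u w + dot v w.
Proof. by rewrite -big_split; apply: eq_bigr => j _; rewrite mxE mulrDl. Qed.

Lemma dotZl a u v : dot (a *: u) v = a * dot u v.
Proof. by rewrite mulr_sumr; apply: eq_bigr => j _; rewrite mxE mulrA. Qed.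

Lemma dotDr u v w : dot w (u + v) = dot w u + dot w v.
Proof. by rewrite dotC dotDl !(dotC w). Qed.

Lemma dotZr a u v : dot u (a *: v) = a * dot u v.
Proof. by rewrite dotC dotZl dotC. Qed.

Lemma dotNl u v : dot (- u) v = - dot u v.
Proof. by rewrite -scaleN1r dotZl mulN1r. Qed.

Lemma dotNr u v : dot u (- v) = - dot u v.
Proof. by rewrite dotC dotNl dotC. Qed.

Definition dotE := (dotDl, dotDr, dotNl, dotNr, dotZl, dotZr).

Lemma dot0l u : dot 0 u = 0.
Proof. by rewrite -(scale0r 0) dotZl mul0r. Qed.

Lemma dot0r u : dot u 0 = 0.
Proof. by rewrite dotC dot0l. Qed.

Lemma dot_suml (I : finType) (F : I -> 'rV[R]_m) v :
  dot (\sum_i F i) v = \sum_i dot (F i) v.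
Proof. by elim/big_ind2: _ => [|? ? ? ? <- <-|//]; rewrite ?dot0l ?dotDl. Qed.

Lemma dot_ge0 u : 0 <= dot u u.
Proof. by apply: sumr_ge0 => j _; rewrite -expr2 sqr_ge0. Qed.

Lemma norm2_ge0 u : 0 <= norm2 u.
Proof. exact: sqrtr_ge0. Qed.

Lemma sqr_norm2 u : norm2 u ^+ 2 = dot u u.
Proof. by rewrite sqr_sqrtr// dot_ge0. Qed.

Lemma dot_eq0 u : dot u u = 0 -> u = 0.
Proof.
move=> u0; apply/rowP => j; rewrite mxE; apply/eqP; rewrite -sqrf_eq0 expr2.
have := @psumr_eq0P _ _ xpredT (fun j => u ord0 j * u ord0 j).
by move=> -> // i _; rewrite -expr2 sqr_ge0.
Qed.

Lemma norm2_eq0 u : norm2 u = 0 -> u = 0.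
Proof. by move=> u0; apply: dot_eq0; rewrite -sqr_norm2 u0 expr0n. Qed.

Lemma norm20 : norm2 (0 : 'rV[R]_m) = 0.
Proof. by rewrite /norm2 dot0l sqrtr0. Qed.

Lemma norm2Z a u : norm2 (a *: u) = `|a| * norm2 u.
Proof. by rewrite /norm2 dotZl dotZr mulrA -expr2 sqrtrM ?sqr_ge0// sqrtr_sqr. Qed.

Lemma norm2N u : norm2 (- u) = norm2 u.
Proof. by rewrite -scaleN1r norm2Z normrN1 mul1r. Qed.

Lemma norm2_le u a : 0 <= a -> (norm2 u <= a) = (dot u u <= a ^+ 2).
Proof. by move=> a0; rewrite -sqr_norm2 ler_pXn2r// nnegrE// norm2_ge0. Qed.

Lemma dot_sqr_le u v : dot u v ^+ 2 <= dot u u * dot v v.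
Proof.
(* The squared norm of this vector expands to |v|^2 (|u|^2 |v|^2 - <u, v>^2). *)
have := dot_ge0 (dot v v *: u - dot u v *: v).
rewrite !dotE (dotC v u) => h.
have := dot_ge0 v; rewrite le_eqVlt => /predU1P[/esym/dot_eq0 ->|v0].
  by rewrite !dot0r mulr0 expr0n.
by rewrite -(ler_pM2l v0); nra.
Qed.

Lemma dot_le u v : dot u v <= norm2 u * norm2 v.
Proof.
have := dot_sqr_le u v; rewrite -!sqr_norm2 -exprMn => h.
have [|/ltW uv] := leP (dot u v) 0.
  by move/le_trans; apply; rewrite mulr_ge0 ?norm2_ge0.
by move: h; rewrite ler_pXn2r// nnegrE ?mulr_ge0 ?norm2_ge0.
Qed.

Lemma norm2D u v : norm2 (u + v) <= norm2 u + norm2 v.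
Proof.
rewrite norm2_le ?addr_ge0 ?norm2_ge0// !dotE (dotC v u).
by have := dot_le u v; have := sqr_norm2 u; have := sqr_norm2 v; nra.
Qed.

Lemma norm2_dual u a : 0 <= a ->
  (forall v, norm2 v <= 1 -> dot u v <= a) -> norm2 u <= a.
Proof.
move=> a0 ua; have [/norm2_eq0 ->|u0] := eqVneq (norm2 u) 0; first by rewrite norm20.
have ugt : 0 < norm2 u by rewrite lt_def u0 norm2_ge0.
have := ua ((norm2 u)^-1 *: u); rewrite norm2Z dotZr -sqr_norm2.
rewrite ger0_norm ?invr_ge0 ?norm2_ge0// mulVf// => /(_ (lexx _)).
by rewrite expr2 mulKf.
Qed.

End Euclidean.

Section Projection.
Context {R : realType} {p : nat}.
Implicit Types (u v h : 'rV[R]_p) (S : {set 'I_p}).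

Lemma proj_onD S u v : proj_on S (u + v) = proj_on S u + proj_on S v.
Proof. by apply/rowP => j; rewrite !mxE; case: ifP; rewrite ?addr0. Qed.

Lemma proj_onZ S (a : R) u : proj_on S (a *: u) = a *: proj_on S u.
Proof. by apply/rowP => j; rewrite !mxE; case: ifP; rewrite ?mulr0. Qed.

Lemma proj_onN S u : proj_on S (- u) = - proj_on S u.
Proof. by rewrite -scaleN1r proj_onZ scaleN1r. Qed.

Lemma proj_on0 S : proj_on S (0 : 'rV[R]_p) = 0.
Proof. by apply/rowP => j; rewrite !mxE; case: ifP. Qed.

Lemma proj_onT u : proj_on [set: 'I_p]%SET u = u.
Proof. by apply/rowP => j; rewrite !mxE finset.in_setT. Qed.

Lemma proj_on_sub S S' u : S \subset S' -> proj_on S' (proj_on S u) = proj_on S u.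
Proof.
move=> /fintype.subsetP SS; apply/rowP => j; rewrite !mxE.
by case: ifP => // jS'; case: ifP => // /SS; rewrite jS'.
Qed.

Lemma proj_on_id S u : proj_on S (proj_on S u) = proj_on S u.
Proof. exact: proj_on_sub. Qed.

Lemma dot_proj_on S u v : dot (proj_on S u) v = dot u (proj_on S v).
Proof.
by apply: eq_bigr => j _; rewrite !mxE; case: ifP => _; rewrite ?mulr0 ?mul0r.
Qed.

Lemma norm2_proj_on S u : norm2 (proj_on S u) <= norm2 u.
Proof.
rewrite norm2_le ?norm2_ge0// sqr_norm2; apply: ler_sum => j _.
by rewrite !mxE; case: ifP => // _; rewrite mulr0 -expr2 sqr_ge0.
Qed.

End Projection.

Section Design.
Context {R : realType} {n p : nat}.
Variable x : 'I_n -> 'rV[R]_p.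
Implicit Types (h : 'rV[R]_p) (v : 'rV[R]_n).

Definition design_app h : 'rV[R]_n := \row_i dot (x i) h.

Definition design_adj v : 'rV[R]_p := \row_j \sum_i v ord0 i * x i ord0 j.

Lemma design_appD h1 h2 : design_app (h1 + h2) = design_app h1 + design_app h2.
Proof. by apply/rowP => i; rewrite !mxE dotDr. Qed.

Lemma design_appZ (a : R) h : design_app (a *: h) = a *: design_app h.
Proof. by apply/rowP => i; rewrite !mxE dotZr. Qed.

Lemma design_appN h : design_app (- h) = - design_app h.
Proof. by rewrite -scaleN1r design_appZ scaleN1r. Qed.

Lemma dot_design h v : dot (design_app h) v = dot h (design_adj v).
Proof.
rewrite /dot; under eq_bigr do rewrite mxE mulr_suml.
rewrite exchange_big/=; apply: eq_bigr => j _; rewrite mxE mulr_sumr.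
by apply: eq_bigr => i _; ring.
Qed.

Lemma design_adjD v w : design_adj (v + w) = design_adj v + design_adj w.
Proof.
apply/rowP => j; rewrite !mxE -big_split; apply: eq_bigr => i _.
by rewrite mxE mulrDl.
Qed.

End Design.

Section Groups.
Context {R : realType} {p M : nat}.
Variable G : 'I_M -> {set 'I_p}.
Implicit Types (h u v : 'rV[R]_p).

Lemma gl_norm_ge0 h : 0 <= gl_norm G h.
Proof. by apply: sumr_ge0 => i _; exact: norm2_ge0. Qed.

Lemma gl_normD u v : gl_norm G (u + v) <= gl_norm G u + gl_norm G v.
Proof.
by rewrite -big_split; apply: ler_sum => i _; rewrite proj_onD norm2D.
Qed.

Lemma gl_normZ (a : R) u : gl_norm G (a *: u) = `|a| * gl_norm G u.
Proof. by rewrite mulr_sumr; apply: eq_bigr => i _; rewrite proj_onZ norm2Z. Qed.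

Lemma gl_normN u : gl_norm G (- u) = gl_norm G u.
Proof. by rewrite -scaleN1r gl_normZ normrN1 mul1r. Qed.

Hypothesis partG : is_group_partition G.

(** Labelling each coordinate by its group turns membership into an equation, the form used to
    exchange sums over groups and coordinates. *)
Lemma group_index : exists f : 'I_p -> 'I_M, forall i j, (j \in G i) = (f j == i).
Proof.
have [injG /and3P[/eqP cov /finset.trivIsetP triv _]] := partG.
have ex j : {i | j \in G i}.
  have : j \in finset.cover [set G i | i in 'I_M]%SET by rewrite cov inE.
  move=> /finset.bigcupP Hj; apply: cid; case: Hj => B /imsetP[i _ ->] jB.
  by exists i.
exists (fun j => sval (ex j)) => i j; case: (ex j) => k /= jk.
apply/idP/eqP => [ji|<-//]; apply/eqP; apply: contraT => ki.
have /pred0P/(_ j) := triv (G k) (G i) (imset_f G isT) (imset_f G isT)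
  (contra_neq (@injG k i) ki).
by rewrite /= jk ji.
Qed.

Lemma group_decomp h : h = \sum_i proj_on (G i) h.
Proof.
have [f fG] := group_index; apply/rowP => j; rewrite summxE (bigD1 (f j))//=.
rewrite mxE fG eqxx big1 ?addr0// => i; rewrite mxE fG eq_sym => /negbTE ->.
by [].
Qed.

Lemma dot_group_decomp h : dot h h = \sum_i dot (proj_on (G i) h) (proj_on (G i) h).
Proof.
rewrite {1}(group_decomp h) dot_suml; apply: eq_bigr => i _.
by rewrite [RHS]dot_proj_on proj_on_id -dot_proj_on.
Qed.

Lemma sum_card_group : (\sum_i #|G i| = p)%N.
Proof.
have [f fG] := group_index.
under eq_bigr do rewrite -sum1_card.
rewrite (exchange_big_dep xpredT)//=.
rewrite -[RHS](card_ord p) -sum1_card; apply: eq_bigr => j _.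
by rewrite (big_pred1 (f j))// => i; rewrite fG eq_sym.
Qed.

Lemma norm2_le_gl_norm h : norm2 h <= gl_norm G h.
Proof.
rewrite {1}(group_decomp h) /gl_norm; elim/big_ind2: _ => //.
  by rewrite norm20.
by move=> u a v b ua vb; apply: (le_trans (norm2D _ _)); exact: lerD.
Qed.

Lemma card_group_gt0 i : (0 < #|G i|)%N.
Proof.
have [_ /and3P[_ _ n0]] := partG; rewrite card_gt0; apply: contraNneq n0 => <-.
exact: imset_f.
Qed.

Lemma card_group_le_max i : (#|G i| <= max_group G)%N.
Proof. exact: (@bigop.leq_bigmax _ (fun i => #|G i|) i). Qed.

Lemma min_group_le_card i : (min_group G <= #|G i|)%N.
Proof.
rewrite /min_group; have := mem_index_enum i; elim: (index_enum _) => // k r IH.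
rewrite inE big_cons => /predU1P[<-|/IH ir]; first exact: geq_minl.
by rewrite geq_min ir orbT.
Qed.

Lemma min_group_gt0 : (0 < M)%N -> (0 < min_group G)%N.
Proof.
(* The minimum has [p] as default value, so [p] must be positive too. *)
move=> M0; have p0 : (0 < p)%N.
  rewrite -sum_card_group; apply: (leq_trans (card_group_gt0 (Ordinal M0))).
  by rewrite (bigD1 (Ordinal M0))//= leq_addr.
rewrite /min_group; elim/big_ind: _ => // [a b a0 b0|i _].
  by rewrite leq_min a0.
exact: card_group_gt0.
Qed.

Lemma min_group_le_max : (0 < M)%N -> (min_group G <= max_group G)%N.
Proof.
move=> M0; apply: (leq_trans (min_group_le_card (Ordinal M0))).
exact: card_group_le_max.
Qed.

End Groups.

(** * Deterministic analysis of the group Lasso *)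

Lemma sum_le_sqrt_card {R : realType} {m : nat} (I : {set 'I_m}) (b : 'I_m -> R) :
  (\sum_(i in I) b i) ^+ 2 <= #|I|%:R * \sum_i b i ^+ 2.
Proof.
have := dot_sqr_le (\row_i (i \in I)%:R : 'rV[R]_m) (\row_i b i).
rewrite /dot.
under eq_bigr do rewrite !mxE.
under [X in _ <= X * _]eq_bigr do rewrite !mxE -natrM mulnb andbb.
under [X in _ <= _ * X]eq_bigr do rewrite !mxE -expr2.
rewrite -natr_sum -big_mkcond sum1_card => h.
rewrite big_mkcond; apply: le_trans h; rewrite le_eqVlt; apply/orP; left.
by apply/eqP; congr (_ ^+ 2); apply: eq_bigr => i _; case: ifP; rewrite ?mul1r ?mul0r.
Qed.

Section GroupLasso.
Context {R : realType} {n p M : nat}.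
Variables (G : 'I_M -> {set 'I_p}) (x : 'I_n -> 'rV[R]_p).
Hypotheses (n0 : (0 < n)%N) (partG : is_group_partition G).

Lemma gl_objectiveE (y : 'I_n -> R) lambda h :
  gl_objective G x y lambda h =
  n%:R^-1 * norm2 (\row_i y i - design_app x h) ^+ 2 + 2 * lambda * gl_norm G h.
Proof.
rewrite sqr_norm2 /gl_objective /dot; congr (_ * _ + _).
by apply: eq_bigr => i _; rewrite !mxE expr2.
Qed.

Lemma gl_norm_proj_group i (u : 'rV[R]_p) :
  gl_norm G (proj_on (G i) u) = norm2 (proj_on (G i) u).
Proof.
have [f fG] := group_index partG.
rewrite /gl_norm (bigD1 i)//= proj_on_id big1 ?addr0// => k ki.
have -> : proj_on (G k) (proj_on (G i) u) = 0; last exact: norm20.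
apply/rowP => j; rewrite !mxE !fG; case: eqP => // ->; case: eqP => // E.
by rewrite E eqxx in ki.
Qed.

Variables (y : 'I_n -> R) (lambda : R) (hhat : 'rV[R]_p).
Hypotheses (l0 : 0 < lambda) (min_hhat : is_group_lasso G x y lambda hhat).
Let r := \row_i y i - design_app x hhat.

(** Minimality tested along a segment. Small t yields the optimality conditions without subgradients
    of the non-smooth norm. *)
Let perturb h (t : R) : 0 < t ->
  2 * t * dot r (design_app x h) <= t ^+ 2 * norm2 (design_app x h) ^+ 2
    + 2 * n%:R * lambda * (gl_norm G (hhat + t *: h) - gl_norm G hhat).
Proof.
move=> t0; have := min_hhat (hhat + t *: h); rewrite !gl_objectiveE.
have -> : \row_i y i - design_app x (hhat + t *: h) = r - t *: design_app x h.
  by rewrite design_appD design_appZ opprD addrA.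
rewrite -/r !sqr_norm2; move: (r) => r1; rewrite !dotE (dotC (design_app x h)).
have n0' : 0 < n%:R :> R by rewrite ltr0n.
rewrite -(ler_pM2l n0') !mulrDr !mulrA mulfV ?gt_eqF// !mul1r.
by set a := dot r1 r1; set b := dot r1 _; set c := dot _ _; nra.
Qed.

(** Stands in for the limit t -> 0: if D > 0, then t = D / (a + D) gives t a <= D < 2 D. The range t
    <= 1 lets the minimizer be shrunk by 1 - t >= 0. *)
Let small_slope (D a : R) : 0 <= a -> (forall t, 0 < t <= 1 -> 2 * D <= t * a) -> D <= 0.
Proof.
move=> a0 H; rewrite leNgt; apply/negP => D0.
have s0 : 0 < a + D by lra.
have := H (D / (a + D)); rewrite divr_gt0//= ler_pdivrMr// mul1r lerDr => /(_ a0).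
rewrite mulrAC ler_pdivlMr//; nra.
Qed.

Lemma group_lasso_dual h : dot r (design_app x h) <= n%:R * lambda * gl_norm G h.
Proof.
rewrite -subr_le0; apply: (@small_slope _ (norm2 (design_app x h) ^+ 2)) => [|t /andP[t0 t1]].
  exact: sqr_ge0.
have := perturb h t0; have := gl_normD G hhat (t *: h).
rewrite gl_normZ gtr0_norm// => tri pt.
have nl : 0 < n%:R * lambda by rewrite mulr_gt0// ltr0n.
rewrite -(ler_pM2l t0).
have : n%:R * lambda * (gl_norm G (hhat + t *: h) - gl_norm G hhat) <=
  n%:R * lambda * (t * gl_norm G h) by rewrite ler_pM2l//; lra.
by move: pt; set u := _ - _; nra.
Qed.

Lemma group_lasso_align : n%:R * lambda * gl_norm G hhat <= dot r (design_app x hhat).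
Proof.
rewrite -subr_le0; apply: (@small_slope _ (norm2 (design_app x hhat) ^+ 2)) => [|t /andP[t0 t1]].
  exact: sqr_ge0.
have := perturb (- hhat) t0.
have -> : hhat + t *: - hhat = (1 - t) *: hhat by rewrite scalerN scalerBl scale1r.
rewrite gl_normZ design_appN norm2N dotNr ger0_norm; last by lra.
move=> pt; rewrite -(ler_pM2l t0); lra.
Qed.

Variables (hstar : 'rV[R]_p) (xi : 'rV[R]_n).
Hypothesis yE : forall i, y i = dot (x i) hstar + xi ord0 i.

Let rE : r = xi - design_app x (hhat - hstar).
Proof.
by apply/rowP => i; rewrite /r !mxE yE !dotE; ring.
Qed.

(* Optimality bounds the dual norm of X^T r by n lambda, so the dual lower
   bound makes the residual r small; pairing r with the fit then bounds the
   norm of the minimizer without constructing an interpolator of the noise. *)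
Lemma group_lasso_norm_le (c : R) : 0 < c ->
  (forall v, exists i, c * norm2 v <= norm2 (proj_on (G i) (design_adj x v))) ->
  gl_norm G hhat <= gl_norm G hstar + norm2 xi / c.
Proof.
move=> c0 low.
have nl : 0 < n%:R * lambda by rewrite mulr_gt0// ltr0n.
have [i ri] := low r.
(* Tested at the block of [design_adj x r] on group [i], optimality reads |block|^2 <= n lambda
   |block|. *)
have rs : norm2 r <= n%:R * lambda / c.
  rewrite ler_pdivlMr// mulrC; apply: (le_trans ri).
  have := group_lasso_dual (proj_on (G i) (design_adj x r)).
  rewrite dotC dot_design gl_norm_proj_group.
  rewrite -(proj_on_id (G i)) dot_proj_on -sqr_norm2 proj_on_id expr2.
  set a := norm2 _; have : 0 <= a := norm2_ge0 _.
  by rewrite le_eqVlt => /predU1P[<- _|a0]; [exact: ltW|rewrite ler_pM2r].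
rewrite -(ler_pM2l nl) mulrDr; apply: (le_trans group_lasso_align).
(* The pairing becomes <r, X hstar> + <r, xi> - |r|^2, and the last term is dropped. *)
have -> : design_app x hhat = design_app x hstar + xi - r.
  by rewrite rE design_appD design_appN; apply/rowP => j; rewrite !mxE; ring.
rewrite dotDr dotDr dotNr.
have h1 := group_lasso_dual hstar.
have h2 := dot_le r xi.
have h3 : norm2 r * norm2 xi <= n%:R * lambda / c * norm2 xi by rewrite ler_wpM2r ?norm2_ge0.
have h4 := dot_ge0 r.
have -> : n%:R * lambda * (norm2 xi / c) = n%:R * lambda / c * norm2 xi by ring.
lra.
Qed.

Lemma group_lasso_prediction :
  norm2 (design_app x (hhat - hstar)) ^+ 2 / n%:R <=
  4 * (norm2 xi ^+ 2 / n%:R) + 4 * lambda * (gl_norm G hstar - gl_norm G hhat).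
Proof.
have n0' : 0 < n%:R :> R by rewrite ltr0n.
have := min_hhat hstar; rewrite !gl_objectiveE -/r rE.
have -> : \row_i y i - design_app x hstar = xi.
  by apply/rowP => i; rewrite !mxE yE; ring.
set z := design_app x _ => h.
(* This avoids a noise cross term, so nothing is assumed on [xi]; the gap is exactly |2 xi -
   z|^2. *)
have h2 : norm2 z ^+ 2 <= 2 * norm2 (xi - z) ^+ 2 + 2 * norm2 xi ^+ 2.
  rewrite !sqr_norm2; have := dot_ge0 (2 *: xi - z).
  by rewrite !dotE (dotC z xi); lra.
rewrite -(ler_pM2r n0') mulrDl -!mulrA mulVf ?gt_eqF// !mulr1.
rewrite -(ler_pM2l n0') !mulrDr !(mulrA n%:R n%:R^-1) mulfV ?gt_eqF// !mul1r in h.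
lra.
Qed.

(** [sigma] is the group norm of the error on the support [I]. Off [I] the error equals [hhat], so
    its mass there is at most [sigma] plus the excess norm of the minimizer. The excess is kept
    because [group_lasso_norm_le] bounds it by the noise. *)
Lemma sparse_cone (s : nat) : group_sparse G s hstar ->
  exists2 sigma, [/\ 0 <= sigma, sigma ^+ 2 <= s%:R * norm2 (hhat - hstar) ^+ 2 &
      gl_norm G hstar - gl_norm G hhat <= sigma] &
    gl_norm G (hhat - hstar) <= 2 * sigma + (gl_norm G hhat - gl_norm G hstar).
Proof.
move=> [I [Is E]].
pose b i := norm2 (proj_on (G i) (hhat - hstar)).
have z0 i : i \notin I -> proj_on (G i) hstar = 0.
  move=> iI; apply: norm2_eq0.
  move: E; rewrite (bigID (mem I))/= => /eqP; rewrite -[X in _ == X]addr0.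
  rewrite (inj_eq (addrI _)) => /eqP.
  by move/psumr_eq0P => -> // k _; exact: norm2_ge0.
have split (u : 'rV[R]_p) : gl_norm G u = \sum_(i in I) norm2 (proj_on (G i) u)
    + \sum_(i | i \notin I) norm2 (proj_on (G i) u).
  by rewrite /gl_norm (bigID (mem I)).
have hI : \sum_(i in I) norm2 (proj_on (G i) hstar) <=
    \sum_(i in I) norm2 (proj_on (G i) hhat) + \sum_(i in I) b i.
  rewrite -big_split; apply: ler_sum => i _; rewrite /b -(norm2N (proj_on _ (_ - _))) -proj_onN.
  have -> : proj_on (G i) hstar = proj_on (G i) hhat + proj_on (G i) (- (hhat - hstar)).
    by rewrite -proj_onD opprB addrC subrK.
  exact: norm2D.
have hIc : \sum_(i | i \notin I) norm2 (proj_on (G i) hhat) = \sum_(i | i \notin I) b i.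
  by apply: eq_bigr => i iI; rewrite /b proj_onD proj_onN z0// subr0.
have hIc0 : \sum_(i | i \notin I) norm2 (proj_on (G i) hstar) = 0.
  by rewrite big1// => i iI; rewrite z0// norm20.
have b0 : 0 <= \sum_(i | i \notin I) b i by apply: sumr_ge0 => i _; exact: norm2_ge0.
exists (\sum_(i in I) b i).
  split.
  - by apply: sumr_ge0 => i _; exact: norm2_ge0.
  - apply: (le_trans (sum_le_sqrt_card I b)); rewrite sqr_norm2 (dot_group_decomp partG).
    rewrite /b; under eq_bigr do rewrite sqr_norm2.
    apply: ler_wpM2r; last by rewrite ler_nat.
    by apply: sumr_ge0 => i _; exact: dot_ge0.
  - by rewrite !split hIc hIc0; lra.
by rewrite !split hIc hIc0 -/(b _); lra.
Qed.

Variables (CE : R).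
Hypotheses (M0 : (0 < M)%N) (CE0 : 0 < CE)
  (lowX : forall h, norm2 h ^+ 2 / 64 <= norm2 (design_app x h) ^+ 2 / n%:R
     + CE * ((max_group G)%:R / n%:R) * gl_norm G h ^+ 2)
  (lowXT : forall v, exists i, Num.sqrt (min_group G)%:R / 16 * norm2 v
     <= norm2 (proj_on (G i) (design_adj x v))).
(** Dictated by the sparse case: two absorbed terms N / 256 leave N / 128 of N / 64; 1024 comes from
    AM-GM and 512 CE from the noise in the remainder of [lowX]. *)
Let C := 128 * (1024 + 512 * CE).
Let W := group_ratio R G.

Let m0 : 0 < (min_group G)%:R :> R.
Proof. by rewrite ltr0n min_group_gt0. Qed.

Let W1 : 1 <= W.
Proof. by rewrite ler_pdivlMr// mul1r ler_nat; exact: min_group_le_max. Qed.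

Let noise := norm2 xi / (Num.sqrt (min_group G)%:R / 16).

Let noise_ge0 : 0 <= noise.
Proof. by rewrite divr_ge0 ?norm2_ge0// divr_ge0 ?sqrtr_ge0. Qed.

(** Source of the factor [W] in the error bounds: noise^2 carries 1 / min |G_i|, the remainder of
    [lowX] carries max |G_i|. *)
Let noiseE : (max_group G)%:R / n%:R * noise ^+ 2 = 256 * (W * (norm2 xi ^+ 2 / n%:R)).
Proof.
rewrite /noise /W /group_ratio expr_div_n expr_div_n (sqr_sqrtr (ler0n R (min_group G))).
have n1 : n%:R != 0 :> R by rewrite pnatr_eq0 -lt0n.
have m1 : (min_group G)%:R != 0 :> R by rewrite gt_eqF.
by field; rewrite n1 m1.
Qed.

Lemma group_lasso_error :
  norm2 (hhat - hstar) ^+ 2 <=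
  C * (W * (norm2 xi ^+ 2 / n%:R)
       + gl_norm G hstar ^+ 2 * ((max_group G)%:R / n%:R)
       + lambda * gl_norm G hstar).
Proof.
have c0 : 0 < Num.sqrt (min_group G)%:R / 16 :> R by rewrite divr_gt0// sqrtr_gt0.
have bh := group_lasso_norm_le c0 lowXT; rewrite -/noise in bh.
have pr := group_lasso_prediction.
have lo := lowX (hhat - hstar).
have tri : gl_norm G (hhat - hstar) <= gl_norm G hhat + gl_norm G hstar.
  by rewrite -(gl_normN _ hstar) gl_normD.
have a0 := gl_norm_ge0 G hstar; have b0 := gl_norm_ge0 G hhat.
have d0 := gl_norm_ge0 G (hhat - hstar).
have e0 : 0 <= norm2 xi ^+ 2 / n%:R by rewrite divr_ge0 ?sqr_ge0.
have g0 : 0 <= (max_group G)%:R / n%:R :> R by [].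
move: bh pr lo tri noiseE a0 b0 d0 e0 g0 noise_ge0 W1 l0; rewrite /C.
set a := gl_norm G hstar; set b := gl_norm G hhat; set D := gl_norm G _.
set e := norm2 xi ^+ 2 / n%:R; set g := (max_group G)%:R / n%:R.
set Q := _ / n%:R; set N := norm2 _ ^+ 2.
move=> bh pr lo tri nE a0 b0 d0 e0 g0 z0 W1' l0'.
(* D <= 2 a + noise, by the triangle inequality and the norm bound for [hhat]. *)
have D2 : D ^+ 2 <= 8 * a ^+ 2 + 2 * noise ^+ 2.
  have : D ^+ 2 <= (2 * a + noise) ^+ 2 by rewrite ler_pXn2r ?nnegrE//; lra.
  have := sqr_ge0 (2 * a - noise); nra.
have gD : g * D ^+ 2 <= 8 * (a ^+ 2 * g) + 512 * (W * e).
  have : g * D ^+ 2 <= g * (8 * a ^+ 2 + 2 * noise ^+ 2) by rewrite ler_wpM2l//.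
  by rewrite mulrDr [g * (2 * _)]mulrCA nE; lra.
have gD' : CE * g * D ^+ 2 <= CE * (8 * (a ^+ 2 * g) + 512 * (W * e)).
  by rewrite -mulrA ler_pM2l//.
have eW : e <= W * e by rewrite ler_peMl//.
have la : 0 <= lambda * a by rewrite mulr_ge0// ltW.
have lb : 0 <= lambda * b by rewrite mulr_ge0// ltW.
have ag : 0 <= a ^+ 2 * g by rewrite mulr_ge0// sqr_ge0.
have hN : N / 64 <= 4 * (W * e) + 4 * (lambda * a) + CE * (8 * (a ^+ 2 * g) + 512 * (W * e)).
  lra.
have We0 : 0 <= W * e by lra.
have p1 : 0 <= CE * (W * e) by rewrite mulr_ge0// ltW.
have p2 : 0 <= CE * (a ^+ 2 * g) by rewrite mulr_ge0// ltW.
have p3 : 0 <= CE * (lambda * a) by rewrite mulr_ge0// ltW.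
nra.
Qed.

Lemma group_lasso_sparse_error (s : nat) : group_sparse G s hstar ->
  s%:R * (max_group G)%:R <= (2048 * CE)^-1 * n%:R ->
  norm2 (hhat - hstar) ^+ 2 <=
  C * (W * (norm2 xi ^+ 2 / n%:R) + s%:R * lambda ^+ 2).
Proof.
move=> sp sg.
have c0 : 0 < Num.sqrt (min_group G)%:R / 16 :> R by rewrite divr_gt0// sqrtr_gt0.
have bh := group_lasso_norm_le c0 lowXT; rewrite -/noise in bh.
have pr := group_lasso_prediction.
have lo := lowX (hhat - hstar).
have [sigma [s0 s2 ab] Ds] := sparse_cone sp.
have d0 := gl_norm_ge0 G (hhat - hstar).
have e0 : 0 <= norm2 xi ^+ 2 / n%:R by rewrite divr_ge0 ?sqr_ge0.
have g0 : 0 <= (max_group G)%:R / n%:R :> R by [].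
(* Multiplied by the factor 8 of [D2], this makes the sparse part of the remainder at most N / 256,
   which the left-hand side absorbs. *)
have sg' : CE * (s%:R * ((max_group G)%:R / n%:R)) <= 2048^-1.
  have h : s%:R * ((max_group G)%:R / n%:R) <= (2048 * CE)^-1.
    by rewrite mulrA ler_pdivrMr ?ltr0n.
  apply: (le_trans (ler_wpM2l (ltW CE0) h)).
  by rewrite invfM mulrCA mulfV ?gt_eqF// mulr1.
move: bh pr lo noiseE d0 e0 g0 noise_ge0 W1 l0 ab Ds s2 sg'; rewrite /C.
set a := gl_norm G hstar; set b := gl_norm G hhat; set D := gl_norm G _.
set e := norm2 xi ^+ 2 / n%:R; set g := (max_group G)%:R / n%:R.
set Q := _ / n%:R; set N := norm2 _ ^+ 2.
move=> bh pr lo nE d0 e0 g0 z0 W1' l0' ab Ds s2 sg'.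
have N0 : 0 <= N := sqr_ge0 _.
have D2 : D ^+ 2 <= 8 * sigma ^+ 2 + 2 * noise ^+ 2.
  have : D ^+ 2 <= (2 * sigma + noise) ^+ 2 by rewrite ler_pXn2r ?nnegrE//; lra.
  have := sqr_ge0 (2 * sigma - noise); nra.
have gD : g * D ^+ 2 <= 8 * (g * (s%:R * N)) + 512 * (W * e).
  have : g * D ^+ 2 <= g * (8 * (s%:R * N) + 2 * noise ^+ 2) by rewrite ler_wpM2l//; lra.
  by rewrite mulrDr [g * (2 * _)]mulrCA nE [g * (8 * _)]mulrCA; lra.
have gD' : CE * g * D ^+ 2 <= CE * (8 * (g * (s%:R * N)) + 512 * (W * e)).
  by rewrite -mulrA ler_pM2l//.
have gsN : CE * (g * (s%:R * N)) <= 2048^-1 * N.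
  have -> : CE * (g * (s%:R * N)) = CE * (s%:R * g) * N by ring.
  by rewrite ler_wpM2r//.
have eW : e <= W * e by rewrite ler_peMl//.
have pr2 : Q <= 4 * e + 4 * (lambda * sigma).
  apply: (le_trans pr); rewrite lerD2l -mulrA ler_pM2l// ler_pM2l//.
have st : 0 <= s%:R :> R by [].
(* AM-GM, using sigma ^ 2 <= s N *)
have amgm : 4 * (lambda * sigma) <= N / 256 + 1024 * (s%:R * lambda ^+ 2).
  have : (lambda * sigma) ^+ 2 <= (s%:R * lambda ^+ 2) * N.
    by rewrite exprMn mulrAC -mulrA [X in _ <= X]mulrC; nra.
  have sl0 : 0 <= s%:R * lambda ^+ 2 by rewrite mulr_ge0// sqr_ge0.
  have ls : 0 <= lambda * sigma by rewrite mulr_ge0// ltW.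
  move=> h; have rhs0 : 0 <= N / 256 + 1024 * (s%:R * lambda ^+ 2) by lra.
  rewrite -(ler_pXn2r (ltn0Sn 1)) ?nnegrE//; last by lra.
  have := sqr_ge0 (N / 256 - 1024 * (s%:R * lambda ^+ 2)); nra.
have We0 : 0 <= W * e by lra.
have p1 : 0 <= CE * (W * e) by rewrite mulr_ge0// ltW.
have sl0 : 0 <= s%:R * lambda ^+ 2 by rewrite mulr_ge0// sqr_ge0.
have p2 : 0 <= CE * (s%:R * lambda ^+ 2) by rewrite mulr_ge0// ltW.
nra.
Qed.

End GroupLasso.

(** * Maurey sampling *)

Lemma exists_le_mean {R : realType} {I : finType} (w F : I -> R) :
  (forall i, 0 <= w i) -> \sum_i w i = 1 -> exists i, F i <= \sum_i w i * F i.
Proof.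
move=> w0 w1; apply: contrapT => /forallNP H.
have Hlt i : \sum_i w i * F i < F i by rewrite ltNge; apply/negP/H.
set m := \sum_i _ in Hlt.
have [i wi] : exists i, 0 < w i.
  apply: contrapT => /forallNP wN; have : \sum_i w i = 0.
    by rewrite big1// => i _; apply/eqP; rewrite eq_le w0 leNgt andbT; apply/negP/wN.
  by rewrite w1 => /eqP; rewrite oner_eq0.
have : \sum_j w j * m < \sum_j w j * F j.
  rewrite (bigD1 i)//= [ltRHS](bigD1 i)//= ltr_leD// ?ltr_pM2l//.
  by apply: ler_sum => j _; rewrite ler_wpM2l// ltW.
by rewrite -mulr_suml w1 mul1r ltxx.
Qed.

(** Indexed by a list because sampled groups may repeat; union bounds then count k-tuples. *)
Definition group_union {p M : nat} (G : 'I_M -> {set 'I_p}) (s : seq 'I_M) : {set 'I_p} :=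
  [set j | has (fun i => j \in G i) s]%SET.

Lemma card_group_union {p M : nat} (G : 'I_M -> {set 'I_p}) s :
  (#|group_union G s| <= size s * max_group G)%N.
Proof.
elim: s => [|i s IH].
  by rewrite leqn0 cards_eq0; apply/eqP/setP => j; rewrite !inE.
have -> : group_union G (i :: s) = (G i :|: group_union G s)%SET.
  by apply/setP => j; rewrite !inE.
rewrite mulSn; apply: (leq_trans (leq_card_setU _ _)); apply: leq_add => //.
exact: card_group_le_max.
Qed.

Section Maurey.
Context {R : realType} {n p : nat}.
Variables (x : 'I_n -> 'rV[R]_p) (c : R).

(** Polar form of Q u = |X u|^2 - c |u|^2, which may be indefinite; the sampling argument uses only
    bilinearity and symmetry. *)
Let Bf (u v : 'rV[R]_p) := dot (design_app x u) (design_app x v) - c * dot u v.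
Let Q u := Bf u u.

Let BfDl u v w : Bf (u + v) w = Bf u w + Bf v w.
Proof. by rewrite /Bf design_appD !dotDl; ring. Qed.
Let BfC u v : Bf u v = Bf v u.
Proof. by rewrite /Bf dotC (dotC u). Qed.
Let BfZl a u v : Bf (a *: u) v = a * Bf u v.
Proof. by rewrite /Bf design_appZ !dotZl; ring. Qed.
Let BfDr u v w : Bf w (u + v) = Bf w u + Bf w v.
Proof. by rewrite BfC BfDl !(BfC w). Qed.
Let BfZr a u v : Bf u (a *: v) = a * Bf u v.
Proof. by rewrite BfC BfZl BfC. Qed.
Let Bf_sumr {I : finType} (F : I -> 'rV[R]_p) u : Bf u (\sum_i F i) = \sum_i Bf u (F i).
Proof.
elim/big_ind2: _ => [|? ? ? ? <- <-|//]; last by rewrite BfDr.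
by have := BfZr 0 u 0; rewrite scale0r mul0r.
Qed.

Let QZ a u : Q (a *: u) = a ^+ 2 * Q u.
Proof. by rewrite /Q BfZl BfZr mulrA. Qed.

(* Derandomized Maurey sampling: replacing one copy of the mean by the best of
   the atoms costs at most the variance of the quadratic form Q. *)
Lemma maurey_sparsify {I : finType} (w : I -> R) (u : I -> 'rV[R]_p) :
  (forall i, 0 <= w i) -> \sum_i w i = 1 ->
  forall k y, exists s : k.-tuple I,
    Q (y + \sum_(i <- s) u i) <=
    Q (y + k%:R *: (\sum_i w i *: u i))
    + k%:R * (\sum_i w i * Q (u i) - Q (\sum_i w i *: u i)).
Proof.
move=> w0 w1; set mu := \sum_i _; elim=> [|k IH] y.
  by exists [tuple]; rewrite big_nil scale0r mul0r !addr0.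
have [i] := exists_le_mean (fun i => Q (y + k%:R *: mu + u i)) w0 w1.
(* The cross terms average to that of the mean, leaving Q at the mean plus the variance. *)
have -> : \sum_i w i * Q (y + k%:R *: mu + u i) =
    Q (y + k.+1%:R *: mu) + (\sum_i w i * Q (u i) - Q mu).
  rewrite -natr1 scalerDl scale1r [y + (_ + _)]addrA; move: (y + _) => z.
  have -> : Q (z + mu) = Q z + 2 * Bf z mu + Q mu.
    by rewrite /Q BfDl !BfDr (BfC mu z); ring.
  have -> : 2 * Bf z mu = \sum_i w i * (2 * Bf z (u i)).
    rewrite Bf_sumr mulr_sumr; apply: eq_bigr => j _; rewrite BfZr; ring.
  have -> : Q z = \sum_i w i * Q z by rewrite -mulr_suml w1 mul1r.
  rewrite -addrA (addrCA (Q mu)) subrr addr0 -!big_split/=; apply: eq_bigr => j _.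
  by rewrite /Q BfDl !BfDr (BfC (u j) z); ring.
move=> ile; have [s sle] := IH (y + u i).
exists (cons_tuple i s); rewrite /= big_cons addrA; apply: (le_trans sle).
rewrite (_ : y + u i + _ = y + k%:R *: mu + u i); last by rewrite addrAC.
by apply: (le_trans (lerD ile (lexx _))); rewrite -natr1; lra.
Qed.

Context {M : nat}.
Variable G : 'I_M -> {set 'I_p}.
Hypothesis partG : is_group_partition G.

(** [h / A] is the mean of the normalized blocks with weights [a i / A]. A sum of k sampled blocks
    lives on a union of k groups, where Q >= 0, so Q can be negative at [h] only as far as the
    variance allows. *)
Lemma sparse_lower_isometry_extend (k : nat) (b : R) : (2 <= k)%N -> 0 <= c -> 0 <= b ->
  (forall (s : k.-tuple 'I_M) th, proj_on (group_union G s) th = th ->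
     c * dot th th <= dot (design_app x th) (design_app x th)) ->
  (forall i th, proj_on (G i) th = th ->
     dot (design_app x th) (design_app x th) <= b * dot th th) ->
  forall h, c * dot h h <= dot (design_app x h) (design_app x h)
                           + 2 * b / k%:R * gl_norm G h ^+ 2.
Proof.
move=> k2 c0 b0 low up h.
set A := gl_norm G h; have A0 : 0 <= A := gl_norm_ge0 G h.
have [A00|An0] := eqVneq A 0.
  have -> : h = 0.
    by apply: norm2_eq0; apply/eqP; rewrite eq_le norm2_ge0 -A00 norm2_le_gl_norm.
  by rewrite dot0r mulr0 A00 expr0n mulr0 addr0 dot_ge0.
have Agt : 0 < A by rewrite lt_def An0.
pose a i := norm2 (proj_on (G i) h).
pose u i := (a i)^-1 *: proj_on (G i) h.
(* A zero block has u i = 0, because the inverse of 0 is 0. *)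
have au i : a i *: u i = proj_on (G i) h.
  rewrite /u scalerA; have [ai|ai] := eqVneq (a i) 0; last by rewrite mulfV// scale1r.
  by rewrite ai mul0r scale0r; apply/esym/norm2_eq0.
have w0 i : 0 <= a i / A by rewrite divr_ge0// norm2_ge0.
have w1 : \sum_i a i / A = 1 by rewrite -mulr_suml mulfV.
have [s] := maurey_sparsify u w0 w1 k 0; rewrite !add0r.
have -> : \sum_i (a i / A) *: u i = A^-1 *: h.
  rewrite [in RHS](group_decomp partG h) scaler_sumr; apply: eq_bigr => i _.
  by rewrite mulrC -scalerA au.
have Q0 : 0 <= Q (\sum_(i <- s) u i).
  rewrite subr_ge0; apply: (low s); apply/rowP => j; rewrite mxE; case: ifP => //.
  move=> /negbT jS; apply/esym; rewrite summxE big_seq big1// => i is_.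
  rewrite !mxE; case: ifP => [ji|]; last by rewrite mulr0.
  by move: jS; rewrite inE => /hasPn/(_ _ is_); rewrite ji.
have Qu i : Q (u i) <= b.
  have uu : dot (u i) (u i) <= 1.
    rewrite dotZl dotZr -sqr_norm2 -/(a i).
    have [->|ai] := eqVneq (a i) 0; first by rewrite expr0n !mulr0.
    by rewrite expr2 mulKf// mulVf.
  have pu : proj_on (G i) (u i) = u i by rewrite proj_onZ proj_on_id.
  have := up i _ pu; have := dot_ge0 (u i); rewrite /Q /Bf; nra.
have EQ : \sum_i a i / A * Q (u i) <= b.
  rewrite -[leRHS]mul1r -w1 mulr_suml; apply: ler_sum => i _.
  exact: ler_wpM2l.
move=> /(le_trans Q0); rewrite (QZ k%:R) !(QZ A^-1) => main.
have k0 : 0 < k%:R :> R by rewrite ltr0n (leq_trans _ k2).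
have kge2 : 2 <= k%:R :> R by rewrite ler_nat.
suff : - (2 * b / k%:R * A ^+ 2) <= Q h by rewrite /Q /Bf; lra.
have [|/ltW Qneg] := leP 0 (Q h).
  by apply: le_trans; rewrite oppr_le0 mulr_ge0 ?sqr_ge0// divr_ge0// ?mulr_ge0// ltW.
set q := A^-1 ^+ 2 * Q h in main.
have qn : q <= 0 by rewrite /q mulr_ge0_le0// sqr_ge0.
have hq : Q h = A ^+ 2 * q by rewrite /q; field.
have m2 : 0 <= k%:R * q + b - q.
  rewrite -(pmulr_rge0 _ k0); apply: (le_trans main).
  by rewrite expr2 -mulrA -mulrDr ler_pM2l// -addrA lerD2l lerD2r.
(* [m2] gives q >= - b / (k - 1), and k >= 2 turns this into - 2 b / k. *)
have m3 : - (2 * b / k%:R) <= q.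
  rewrite -mulNr ler_pdivrMr//; nra.
by rewrite hq -mulNr mulrC ler_wpM2l// sqr_ge0.
Qed.

End Maurey.

(** * Nets *)

Lemma expR1_le3 {R : realType} : expR 1 <= 3 :> R.
Proof.
have -> : expR 1 = (expR (- (1 / 8)) ^+ 8)^-1 :> R.
  by rewrite -expRM_natl -expRN; congr expR; field.
rewrite -[leRHS]invrK lef_pV2 ?posrE ?invr_gt0 ?exprn_gt0 ?expR_gt0//.
apply: (@le_trans _ _ ((7 / 8) ^+ 8)); first by rewrite !exprS expr0; lra.
by rewrite lerXn2r ?nnegrE ?expR_ge0//; have := expR_ge1Dx (- (1 / 8) : R); lra.
Qed.

(** Integers are encoded by sign and size, with zero counted twice. This gives two geometric series,
    each at most 2 / eps because exp(- eps) <= 1 - eps / 2. *)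
Lemma sum_expR_geometric_le {R : realType} (eps : R) (B : nat) : 0 < eps <= 1 ->
  \sum_(k : bool * 'I_B) expR (- (eps * k.2%:R)) <= 4 / eps.
Proof.
move=> /andP[e0 e1].
have -> : \sum_(k : bool * 'I_B) expR (- (eps * k.2%:R)) =
    \sum_(b : bool) \sum_(i < B) expR (- (eps * i%:R)).
  by rewrite pair_big_dep; apply: eq_big.
rewrite big_bool/=; set S := \sum_(i < B) _.
have -> : 4 / eps = 2 / eps + 2 / eps by ring.
suff : S <= 2 / eps by move=> ?; lra.
set q := expR (- eps).
have SE : S = \sum_(i < B) q ^+ i.
  by apply: eq_bigr => i _; rewrite -expRM_natr mulNr.
have q0 : 0 < q := expR_gt0 _.
have qe : q <= 1 - eps / 2.
  have qI : q * expR eps = 1 by rewrite -expRD addrC subrr expR0.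
  have := expR_ge1Dx eps; nra.
have S0 : 0 <= S by apply: sumr_ge0 => i _; exact: expR_ge0.
have := subrX1 q B; rewrite -SE => h.
have qB : 0 <= q ^+ B by rewrite exprn_ge0// ltW.
rewrite ler_pdivlMr//; nra.
Qed.

(** Counting in the manner of Markov: every counted [z] has weight at least exp(- eps L), and the
    total weight factorizes over coordinates. Off [S] the weight is an indicator, contributing a
    factor 1. *)
Lemma card_weighted_le {R : realType} {p B : nat} (S : {set 'I_p}) (eps L : R) :
  0 < eps <= 1 ->
  #|[set z : {ffun 'I_p -> bool * 'I_B.+1} |
      ((\sum_(j in S) (z j).2)%N%:R <= L) && [forall (j | j \notin S), z j == (false, ord0)]]%SET|%:R
  <= expR (eps * L) * (4 / eps) ^+ #|S|.
Proof.
move=> e01; have /andP[e0 _] := e01.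
pose w (j : 'I_p) (k : bool * 'I_B.+1) : R :=
  if j \in S then expR (- (eps * k.2%:R)) else (k == (false, ord0))%:R.
have w0 j k : 0 <= w j k by rewrite /w; case: ifP => // _; exact: expR_ge0.
set F := [set z | _]%SET.
apply: (@le_trans _ _ (\sum_(z in F) expR (eps * L) * \prod_j w j (z j))).
  rewrite -sum1_card natr_sum; apply: ler_sum => z; rewrite inE => /andP[zL /forall_inP zS].
  rewrite (bigID (mem S))/= [X in _ * (_ * X)]big1 ?mulr1; last first.
    by move=> j jS; rewrite /w (negbTE jS) (eqP (zS j jS)) eqxx.
  under eq_bigr => j jS do rewrite /w jS.
  rewrite -expR_sum -expRD -[leLHS]expR0 ler_expR sumrN -mulr_sumr subr_ge0.
  by rewrite ler_pM2l// -natr_sum.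
rewrite -mulr_sumr ler_wpM2l ?expR_ge0//.
apply: (@le_trans _ _ (\sum_(z : {ffun 'I_p -> bool * 'I_B.+1}) \prod_j w j (z j))).
  rewrite [leRHS](bigID (mem F))/= lerDl; apply: sumr_ge0 => z _.
  exact: prodr_ge0.
rewrite -bigA_distr_bigA (bigID (mem S))/= [X in _ * X]big1 ?mulr1; last first.
  move=> j jS; rewrite /w (negbTE jS) (bigD1 (false, ord0))//= ?eqxx big1 ?addr0//.
  by move=> k /negbTE ->.
rewrite -prodr_const; apply: ler_prod => j jS; rewrite sumr_ge0//=.
under eq_bigr do rewrite /w jS.
exact: sum_expR_geometric_le.
Qed.

(* The net is a grid of mesh eps / sqrt D, D = #|S|. Rounding towards 0 keeps
   the l1 norm of the integer coordinates below D / eps, and the number of such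
   grid points is controlled by the generating function
   (sum_k e^(- eps |k|)) ^ D. *)
Lemma ball_net {R : realType} {p : nat} (S : {set 'I_p}) (eps : R) : 0 < eps <= 1 ->
  exists N : seq 'rV[R]_p,
    [/\ (size N)%:R <= (12 / eps) ^+ #|S|,
        (forall v, v \in N -> proj_on S v = v /\ norm2 v <= 1) &
        forall th, proj_on S th = th -> norm2 th <= 1 ->
          exists2 v, v \in N & norm2 (th - v) <= eps].
Proof.
move=> e01; have /andP[e0 e1] := e01.
have [S0|Spos] := posnP #|S|.
  exists [:: 0]; split; first by rewrite S0 expr0.
    by move=> v; rewrite inE => /eqP ->; rewrite proj_on0 norm20.
  move=> th thS _; exists 0; first by rewrite inE.
  rewrite -thS subr0 (_ : proj_on _ _ = 0) ?norm20 ?(ltW e0)//.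
  by apply/rowP => j; rewrite !mxE (card0_eq S0).
set D : R := #|S|%:R; have D0 : 0 < D by rewrite ltr0n.
set sD := Num.sqrt D; have sD0 : 0 < sD by rewrite sqrtr_gt0.
have sDD : sD ^+ 2 = D by rewrite sqr_sqrtr// ltW.
set dl := eps / sD; have dl0 : 0 < dl by rewrite divr_gt0.
pose L := D / eps; have L0 : 0 <= L by rewrite divr_ge0// ltW.
pose B := Num.truncn L.
pose vec (z : {ffun 'I_p -> bool * 'I_B.+1}) : 'rV[R]_p :=
  \row_j (if j \in S then (-1) ^+ (z j).1 * ((z j).2%:R * dl) else 0).
set F := [set z : {ffun 'I_p -> bool * 'I_B.+1} |
  ((\sum_(j in S) (z j).2)%N%:R <= L) && [forall (j | j \notin S), z j == (false, ord0)]]%SET.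
exists [seq v <- [seq vec z | z <- enum F] | norm2 v <= 1]; split.
- apply: (@le_trans _ _ #|F|%:R).
    by rewrite ler_nat size_filter (leq_trans (count_size _ _))// size_map -cardE.
  apply: (le_trans (card_weighted_le S L e01)).
  (* eps L = D, so the exponential costs e <= 3 per coordinate, and 12 is 3 times 4. *)
  have -> : eps * L = 1 * #|S|%:R by rewrite /L mul1r mulrC divfK// gt_eqF.
  have e4 : 0 <= 4 / eps by rewrite divr_ge0// ltW.
  have -> : 12 / eps = 3 * (4 / eps) by ring.
  rewrite expRM_natr -exprMn; apply: lerXn2r; rewrite ?nnegrE ?mulr_ge0 ?expR_ge0 ?invr_ge0 ?(ltW e0)//.
  by rewrite ler_wpM2r// expR1_le3.
- move=> v; rewrite mem_filter => /andP[v1 /mapP[z _ vE]]; split=> //.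
  by rewrite vE; apply/rowP => j; rewrite !mxE; case: ifP => // ->.
move=> th thS th1.
(* Rounding absolute values down also keeps the point in the unit ball and moves each coordinate by
   at most [dl]. *)
pose mj j := Num.truncn (`|th ord0 j| / dl).
have mjle j : (mj j)%:R * dl <= `|th ord0 j|.
  by rewrite -ler_pdivlMr// truncn_le divr_ge0// ltW.
have mdl0 j : 0 <= (mj j)%:R * dl by apply: mulr_ge0; [exact: ler0n|exact: ltW].
have mjgt j : `|th ord0 j| - (mj j)%:R * dl <= dl.
  have := truncnS_gt (`|th ord0 j| / dl).
  rewrite ltr_pdivrMr// -/(mj j) -natr1 mulrDl mul1r => /ltW; lra.
have summ : (\sum_(j in S) mj j)%N%:R <= L.
  have h1 : (\sum_(j in S) mj j)%N%:R * dl <= \sum_(j in S) `|th ord0 j|.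
    by rewrite natr_sum mulr_suml; apply: ler_sum.
  have h2 : \sum_(j in S) `|th ord0 j| <= sD.
    rewrite -(ler_pXn2r (ltn0Sn 1)) ?nnegrE ?sumr_ge0 ?(ltW sD0)// sDD.
    apply: (le_trans (sum_le_sqrt_card S _)); rewrite -[leRHS]mulr1 ler_wpM2l ?(ltW D0)//.
    rewrite -(expr1n _ 2); move: th1; rewrite norm2_le//; apply: le_trans.
    by apply: ler_sum => j _; rewrite real_normK ?num_real// expr2.
  have := le_trans h1 h2; rewrite -ler_pdivlMr//; move/le_trans; apply.
  by rewrite /dl /L -sDD le_eqVlt; apply/orP; left; apply/eqP; field; rewrite !gt_eqF.
have mB j : j \in S -> (mj j < B.+1)%N.
  move=> jS; rewrite ltnS truncn_ge_nat//; apply: le_trans summ.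
  by rewrite ler_nat (bigD1 j)//= leq_addr.
pose z : {ffun 'I_p -> bool * 'I_B.+1} :=
  [ffun j => if j \in S then (th ord0 j < 0, inord (mj j)) else (false, ord0)].
have zE j : vec z ord0 j = if j \in S then (-1) ^+ (th ord0 j < 0)%R * ((mj j)%:R * dl) else 0.
  by rewrite mxE ffunE; case: ifP => // jS; rewrite ?jS /= inordK// mB.
have th0 j : j \notin S -> th ord0 j = 0 by move=> /negbTE jS; rewrite -thS mxE jS.
exists (vec z).
  rewrite mem_filter; apply/andP; split.
    apply: le_trans th1; rewrite norm2_le ?norm2_ge0// sqr_norm2.
    apply: ler_sum => j _; rewrite zE; case: ifP => [jS|_]; last by rewrite mulr0 -expr2 sqr_ge0.
    rewrite -!expr2 exprMn sqrr_sign mul1r -[X in _ <= X]real_normK ?num_real//.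
    by rewrite lerXn2r ?nnegrE ?mdl0.
  apply: map_f; rewrite mem_enum inE; apply/andP; split.
    apply: le_trans summ; rewrite ler_nat; apply: leq_sum => j jS.
    by rewrite ffunE jS/= inordK// mB.
  by apply/forall_inP => j /negbTE jS; rewrite ffunE jS.
rewrite norm2_le ?(ltW e0)//.
have -> : eps ^+ 2 = \sum_(j in S) dl ^+ 2.
  by rewrite sumr_const -mulr_natl -/D -sDD /dl expr_div_n mulrC divfK// gt_eqF// exprn_gt0.
rewrite [leRHS]big_mkcond; apply: ler_sum => j _; rewrite !mxE -/(vec z).
have := zE j; rewrite mxE => ->; case: ifP => [jS|/negbT jS]; last by rewrite th0// subr0 mulr0.
rewrite -expr2 {1}(realEsign (num_real (th ord0 j))) -mulrBr exprMn sqrr_sign mul1r.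
by rewrite lerXn2r ?nnegrE ?(ltW dl0)// subr_ge0.
Qed.

Definition is_ball_net {R : realType} {p : nat} (S : {set 'I_p}) (eps : R)
    (N : seq 'rV[R]_p) : Prop :=
  (forall v, v \in N -> proj_on S v = v /\ norm2 v <= 1) /\
  forall th, proj_on S th = th -> norm2 th <= 1 ->
    exists2 v, v \in N & norm2 (th - v) <= eps.

Lemma norm2_normalize {R : realType} {p : nat} (u : 'rV[R]_p) : norm2 u != 0 ->
  norm2 ((norm2 u)^-1 *: u) = 1.
Proof.
by move=> u0; rewrite norm2Z ger0_norm ?invr_ge0 ?norm2_ge0// mulVf.
Qed.

(** * From net points to all vectors *)

Section Nets.
Context {R : realType} {n p : nat}.
Variable x : 'I_n -> 'rV[R]_p.

(** The supremum K of the bilinear form over both balls satisfies K <= t + K / 4 + K / 4 when each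
    argument is replaced by a net point at distance 1 / 4; hence K <= 2 t. *)
Lemma op_bound_of_net (S : {set 'I_p}) (t : R) (N1 : seq 'rV[R]_p) (N2 : seq 'rV[R]_n) :
  is_ball_net S (1 / 4) N1 -> is_ball_net [set: 'I_n]%SET (1 / 4) N2 ->
  (forall u v, u \in N1 -> v \in N2 -> dot (design_app x u) v <= t) ->
  forall th, proj_on S th = th -> norm2 (design_app x th) <= 2 * t * norm2 th.
Proof.
move=> [N1S N1c] [N2S N2c] tN.
pose E := [set r : R | exists th v, [/\ proj_on S th = th, norm2 th <= 1, norm2 v <= 1 &
  r = dot (design_app x th) v]].
have E0 : E 0 by exists 0, 0; rewrite proj_on0 !norm20 dot0r.
(* The Frobenius norm of the design bounds K; finiteness is what allows K / 2 to be cancelled. *)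
have ubE : has_ubound E.
  exists (Num.sqrt (\sum_i dot (x i) (x i))) => r [th [v [_ th1 v1 ->]]].
  have h : norm2 (design_app x th) <= Num.sqrt (\sum_i dot (x i) (x i)).
    rewrite norm2_le ?sqrtr_ge0// sqr_sqrtr; last by apply: sumr_ge0 => i _; exact: dot_ge0.
    rewrite /dot; apply: ler_sum => i _; rewrite !mxE -expr2.
    apply: (le_trans (dot_sqr_le _ _)); rewrite -[leRHS]mulr1 ler_wpM2l ?dot_ge0//.
    by rewrite -sqr_norm2 expr_le1 ?norm2_ge0.
  apply: (le_trans (dot_le _ _)); apply: le_trans h.
  by rewrite ler_piMr ?norm2_ge0.
set K := sup E.
have K0 : 0 <= K by exact: ub_le_sup.
have homog th v : proj_on S th = th -> dot (design_app x th) v <= K * norm2 th * norm2 v.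
  move=> thS; have [/norm2_eq0 ->|th0] := eqVneq (norm2 th) 0.
    by rewrite dot_design dot0l norm20 mulr0 mul0r.
  have [/norm2_eq0 ->|v0] := eqVneq (norm2 v) 0; first by rewrite dot0r norm20 mulr0.
  have : dot (design_app x ((norm2 th)^-1 *: th)) ((norm2 v)^-1 *: v) <= K.
    apply: ub_le_sup => //; exists ((norm2 th)^-1 *: th), ((norm2 v)^-1 *: v).
    by rewrite !norm2_normalize// proj_onZ thS.
  rewrite design_appZ dotZl dotZr mulrA -invfM mulrC ler_pdivrMr.
    by rewrite mulrA.
  by rewrite mulr_gt0// lt_def norm2_ge0 andbT.
have Kt : K <= t + K / 2.
  apply: sup_le_ub; first by exists 0.
  move=> r [th [v [thS th1 v1 ->]]].
  have [u uN ue] := N1c th thS th1.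
  have [w wN we] := N2c v (proj_onT v) v1.
  have [uS u1] := N1S u uN.
  have -> : dot (design_app x th) v = dot (design_app x u) w +
      (dot (design_app x (th - u)) w + dot (design_app x th) (v - w)).
    by rewrite design_appD design_appN !dotE; ring.
  apply: lerD; first exact: tN.
  have [_ w1] := N2S w wN.
  have tuS : proj_on S (th - u) = th - u by rewrite proj_onD proj_onN thS uS.
  have h1 := homog _ w tuS; have h2 := homog _ (v - w) thS.
  have h3 : K * norm2 (th - u) * norm2 w <= K * (1 / 4) * 1.
    by apply: ler_pM; rewrite ?mulr_ge0 ?norm2_ge0// ler_wpM2l.
  have h4 : K * norm2 th * norm2 (v - w) <= K * 1 * (1 / 4).
    by apply: ler_pM; rewrite ?mulr_ge0 ?norm2_ge0// ler_wpM2l.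
  lra.
move=> th thS.
have t0 : 0 <= t by lra.
have Kth : K * norm2 th <= 2 * t * norm2 th by rewrite ler_wpM2r ?norm2_ge0//; lra.
apply: norm2_dual; first by rewrite !mulr_ge0 ?norm2_ge0.
move=> v v1; apply: (le_trans (homog _ _ thS)); apply: le_trans Kth.
by rewrite ler_piMr// mulr_ge0 ?norm2_ge0.
Qed.

(** The net lies in the ball, not on the sphere: a net point near a unit vector has norm at least 1
    - eps only, whence that factor. *)
Lemma lower_isometry_of_net (S : {set 'I_p}) (eps a B : R) (N : seq 'rV[R]_p) :
  is_ball_net S eps N -> 0 <= a ->  0 <= B ->
  (forall th, proj_on S th = th -> norm2 (design_app x th) <= B * norm2 th) ->
  (forall u, u \in N -> a * norm2 u <= norm2 (design_app x u)) ->
  forall th, proj_on S th = th ->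
    (a * (1 - eps) - B * eps) * norm2 th <= norm2 (design_app x th).
Proof.
move=> [NS Nc] a0 B0 op low th thS.
have [->|th0] := eqVneq (norm2 th) 0; first by rewrite mulr0 norm2_ge0.
have thp : 0 < norm2 th by rewrite lt_def th0 norm2_ge0.
set w := (norm2 th)^-1 *: th.
have w1 : norm2 w = 1 by exact: norm2_normalize.
have w1' : norm2 w <= 1 by rewrite w1.
have wS : proj_on S w = w by rewrite proj_onZ thS.
suff : a * (1 - eps) - B * eps <= norm2 (design_app x w).
  rewrite design_appZ norm2Z ger0_norm ?invr_ge0 ?norm2_ge0// [_^-1 * _]mulrC ler_pdivlMr//.
have [u uN ue] := Nc w wS w1'.
have [uS _] := NS u uN.
have wuS : proj_on S (w - u) = w - u by rewrite proj_onD proj_onN wS uS.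
have h1 := low u uN.
have h2 := op _ wuS.
have h3 : B * norm2 (w - u) <= B * eps by rewrite ler_wpM2l.
have h4 : 1 - eps <= norm2 u.
  by have := norm2D (w - u) u; rewrite subrK w1; lra.
have h5 : a * (1 - eps) <= a * norm2 u by rewrite ler_wpM2l.
have h6 : norm2 (design_app x u) <= norm2 (design_app x w) + norm2 (design_app x (w - u)).
  have -> : design_app x u = design_app x w + - design_app x (w - u).
    by rewrite -design_appN -design_appD opprB addrC subrK.
  by apply: (le_trans (norm2D _ _)); rewrite norm2N.
lra.
Qed.

Lemma dual_lower_of_net {M : nat} (G : 'I_M -> {set 'I_p}) (eps B : R) (N : seq 'rV[R]_n) :
  is_group_partition G -> (0 < M)%N -> is_ball_net [set: 'I_n]%SET eps N ->
  0 <= B ->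
  (forall i th, proj_on (G i) th = th -> norm2 (design_app x th) <= B * norm2 th) ->
  (forall u, u \in N -> p%:R / 16 * dot u u <= dot (design_adj x u) (design_adj x u)) ->
  forall v, exists i,
    (Num.sqrt (min_group G)%:R / 4 * (1 - eps) - B * eps) * norm2 v <=
    norm2 (proj_on (G i) (design_adj x v)).
Proof.
move=> partG M0 [_ Nc] B0 op low v.
set c := Num.sqrt _ / 4.
have c0 : 0 <= c by rewrite divr_ge0// sqrtr_ge0.
have [v0|v0] := eqVneq (norm2 v) 0.
  by exists (Ordinal M0); rewrite v0 mulr0 norm2_ge0.
have vp : 0 < norm2 v by rewrite lt_def v0 norm2_ge0.
set w := (norm2 v)^-1 *: v.
have w1 : norm2 w = 1 by exact: norm2_normalize.
have w1' : norm2 w <= 1 by rewrite w1.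
have adjZ (b : R) u : design_adj x (b *: u) = b *: design_adj x u.
  apply/rowP => j; rewrite !mxE mulr_sumr; apply: eq_bigr => i _.
  by rewrite mxE mulrA.
have dual i u : norm2 (proj_on (G i) (design_adj x u)) <= B * norm2 u.
  apply: norm2_dual; first by rewrite mulr_ge0 ?norm2_ge0.
  move=> h h1; rewrite dot_proj_on dotC -dot_design; apply: (le_trans (dot_le _ _)).
  rewrite ler_wpM2r ?norm2_ge0//; apply: (le_trans (op i _ (proj_on_id _ _))).
  by rewrite ler_piMr//; apply: le_trans h1; exact: norm2_proj_on.
have [u uN ue] := Nc w (proj_onT w) w1'.
(* Pigeonhole over the groups, using min |G_i| <= |G_i| for each of them. *)
have [i hi] : exists i, c * norm2 u <= norm2 (proj_on (G i) (design_adj x u)).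
  apply: contrapT => /forallNP H.
  have Hlt i : dot (proj_on (G i) (design_adj x u)) (proj_on (G i) (design_adj x u)) <
      #|G i|%:R / 16 * dot u u.
    have := H i; move/negP; rewrite -ltNge -!sqr_norm2 => h.
    apply: (@lt_le_trans _ _ ((c * norm2 u) ^+ 2)).
      by rewrite ltr_pXn2r// nnegrE ?norm2_ge0// mulr_ge0// norm2_ge0.
    rewrite exprMn ler_wpM2r ?sqr_ge0// /c expr_div_n sqr_sqrtr//.
    have : (min_group G)%:R <= #|G i|%:R :> R by rewrite ler_nat min_group_le_card.
    lra.
  have := low u uN; rewrite (dot_group_decomp partG) leNgt => /negP; apply.
  have -> : p%:R / 16 * dot u u = \sum_i #|G i|%:R / 16 * dot u u.
    by rewrite -!mulr_suml -natr_sum sum_card_group.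
  by apply: ltr_sum => //; apply/hasP; exists (Ordinal M0); rewrite ?mem_index_enum.
exists i.
suff : c * (1 - eps) - B * eps <= norm2 (proj_on (G i) (design_adj x w)).
  by rewrite adjZ proj_onZ norm2Z ger0_norm ?invr_ge0 ?norm2_ge0// [_^-1 * _]mulrC ler_pdivlMr.
have h2 := dual i (w - u).
have h3 : B * norm2 (w - u) <= B * eps by rewrite ler_wpM2l.
have h4 : 1 - eps <= norm2 u.
  by have := norm2D (w - u) u; rewrite subrK w1; lra.
have h5 : c * (1 - eps) <= c * norm2 u by rewrite ler_wpM2l.
have h6 : norm2 (proj_on (G i) (design_adj x u)) <=
    norm2 (proj_on (G i) (design_adj x w)) + norm2 (proj_on (G i) (design_adj x (w - u))).
  have -> : proj_on (G i) (design_adj x u) =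
      proj_on (G i) (design_adj x w) + - proj_on (G i) (design_adj x (w - u)).
    rewrite -proj_onN -proj_onD; congr proj_on.
    by rewrite -scaleN1r -adjZ -design_adjD scaleN1r opprB addrC subrK.
  by apply: (le_trans (norm2D _ _)); rewrite norm2N.
lra.
Qed.

End Nets.

(** * Gaussian tail bounds *)

(** The right-hand side sees [mu], [Y] and [w] only through weighted integrals of indicators, so two
    settings that agree on indicators agree on every nonnegative [g]. *)
Lemma integral_weighted_comp_lim {R : realType} {d d' : measure_display}
    {T : measurableType d} {U : measurableType d'}
    (mu : {measure set T -> \bar R}) (Y : T -> U) (w : T -> R) (g : U -> R)
    (g0 : forall u, (0 <= (g u)%:E)%E) (mg : measurable_fun setT (EFin \o g)) :
  measurable_fun setT Y -> measurable_fun setT w -> (forall t, 0 <= w t) ->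
  (\int[mu]_t (g (Y t) * w t)%:E)%E =
  limn (fun n => (\sum_(y \in range (nnsfun_approx measurableT mg n))
     y%:E * \int[mu]_t (\1_(nnsfun_approx measurableT mg n @^-1` [set y]) (Y t) * w t)%:E)%E).
Proof.
move=> mY mw w0.
set h := nnsfun_approx measurableT mg.
have mhY n : measurable_fun setT (fun t => h n (Y t)).
  by apply: (measurableT_comp _ mY); exact/measurable_funP.
transitivity (limn (fun n => (\int[mu]_t (h n (Y t) * w t)%:E)%E)).
  rewrite -monotone_convergence//=.
  - apply: eq_integral => t _; apply/esym/cvg_lim => //.
    have -> : (fun n => (h n (Y t) * w t)%:E) = (fun n => (h n (Y t))%:E * (w t)%:E)%E.
      by apply/funext => n; rewrite EFinM.
    rewrite EFinM; apply: cvgeZr => //.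
    exact: (@cvg_nnsfun_approx _ _ _ _ measurableT _ mg (fun u _ => g0 u) (Y t) I).
  - by move=> n; apply/measurable_EFinP/measurable_funM.
  - by move=> n t _; rewrite lee_fin mulr_ge0.
  - move=> t _ a b ab; rewrite lee_fin ler_wpM2r//.
    by have /lefP := @nd_nnsfun_approx _ _ _ _ measurableT _ mg a b ab; exact.
congr (limn _); apply/funext => n.
have mi (y : R) : measurable_fun setT (fun t => \1_(h n @^-1` [set y]) (Y t) : R).
  apply: (measurableT_comp _ mY); apply: measurable_indic.
  exact: measurable_funPTI.
transitivity (\int[mu]_t (\sum_(y \in range (h n))
   y%:E * (\1_(h n @^-1` [set y]) (Y t) * w t)%:E)%E)%E.
  apply: eq_integral => t _; rewrite (fimfunE (h n) (Y t)).
  rewrite !fsbig_finite//= mulr_suml -sumEFin; apply: eq_bigr => y _.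
  by rewrite -EFinM mulrA.
rewrite ge0_integral_fsum//=.
- rewrite !fsbig_finite//= ; apply: eq_big_seq => y yh.
  rewrite ge0_integralZl_EFin//.
  + by move=> t _; rewrite lee_fin mulr_ge0.
  + by apply/measurable_EFinP/measurable_funM.
  + move: yh; rewrite in_fset_set// inE => -[x _ <-]; exact: fun_ge0.
- move=> y; apply: measurable_funeM; by apply/measurable_EFinP/measurable_funM.
- move=> y t _. rewrite -EFinM lee_fin mulrA mulr_ge0// indicE.
  case: (boolP (Y t \in _)) => [|_]; last by rewrite mulr0.
  by rewrite inE => /= <-; rewrite mulr1 fun_ge0.
Qed.

(** The weight plays two parts: the remaining factors of a product in [integral_prod_comp], and a
    density in [normal_mgf]. *)
Lemma eq_integral_weighted_comp {R : realType} {d1 d2 d' : measure_display}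
    {T1 : measurableType d1} {T2 : measurableType d2} {U : measurableType d'}
    (mu1 : {measure set T1 -> \bar R}) (mu2 : {measure set T2 -> \bar R})
    (Y1 : T1 -> U) (Y2 : T2 -> U) (w1 : T1 -> R) (w2 : T2 -> R) (g : U -> R) :
  measurable_fun setT Y1 -> measurable_fun setT w1 -> (forall t, 0 <= w1 t) ->
  measurable_fun setT Y2 -> measurable_fun setT w2 -> (forall t, 0 <= w2 t) ->
  (forall B, measurable B -> (\int[mu1]_t (\1_B (Y1 t) * w1 t)%:E =
     \int[mu2]_t (\1_B (Y2 t) * w2 t)%:E)%E) ->
  measurable_fun setT g -> (forall u, 0 <= g u) ->
  (\int[mu1]_t (g (Y1 t) * w1 t)%:E = \int[mu2]_t (g (Y2 t) * w2 t)%:E)%E.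
Proof.
move=> mY1 mw1 w10 mY2 mw2 w20 eqB mg g0.
have g0' u : (0 <= (g u)%:E)%E by rewrite lee_fin.
have mg' : measurable_fun setT (fun u => (g u)%:E) by exact/measurable_EFinP.
rewrite (integral_weighted_comp_lim mu1 g0' mg' mY1 mw1 w10).
rewrite (integral_weighted_comp_lim mu2 g0' mg' mY2 mw2 w20).
congr (limn _); apply/funext => n; apply: eq_fsbigr => y _.
by congr (_ * _)%E; apply: eqB; exact: measurable_funPTI.
Qed.

(** Independence is known on boxes only. Coordinates pass one at a time from indicators to general
    factors: [s] lists those allowed to be general, and all factors but one form the weight. This
    bypasses product measures and Fubini. *)
Lemma integral_prod_comp {R : realType} {d d' : measure_display}
    {T : measurableType d} {U : measurableType d'} {I : finType}
    (P : {measure set T -> \bar R}) (gamma : probability U R)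
    (Y : I -> T -> U) :
  (forall a, measurable_fun setT (Y a)) ->
  (forall B : I -> set U, (forall a, measurable (B a)) ->
     P (\bigcap_a (Y a @^-1` B a)) = (\prod_a gamma (B a))%E) ->
  forall f : I -> U -> R, (forall a, measurable_fun setT (f a)) ->
    (forall a u, 0 <= f a u) ->
    (forall a, \int[gamma]_u (f a u)%:E < +oo)%E ->
  (\int[P]_t (\prod_a f a (Y a t))%:E = \prod_a \int[gamma]_u (f a u)%:E)%E.
Proof.
move=> mY box.
suff H (s : seq I) (f : I -> U -> R) : (forall a, measurable_fun setT (f a)) ->
    (forall a u, 0 <= f a u) ->
    (forall a, \int[gamma]_u (f a u)%:E < +oo)%E ->
    (forall a, a \notin s -> exists2 B, measurable B & f a = \1_B) ->
    (\int[P]_t (\prod_a f a (Y a t))%:E = \prod_a \int[gamma]_u (f a u)%:E)%E.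
  by move=> f mf f0 foo; apply: (H (enum I)) => // a; rewrite mem_enum.
elim: s f => [|a s IH] f mf f0 foo find.
  have [B BP] : {B : I -> set U & forall a, measurable (B a) /\ f a = \1_(B a)}.
    by apply: (@choice _ _ (fun a B => measurable B /\ f a = \1_B)) => a;
      have [//|B ? ?] := find a; exists B.
  under eq_integral => t _.
    have -> : \prod_a f a (Y a t) = \1_(\bigcap_a (Y a @^-1` B a)) t.
      rewrite indicE; case: (boolP (t \in _)) => [|/negP].
        rewrite inE => Bt; rewrite big1// => a _.
        by rewrite (BP a).2 indicE mem_set//; exact: Bt.
      rewrite inE /bigcap/= => Bt.
      have [a nBa] : exists a, ~ B a (Y a t).
        by apply/existsNP => H; apply: Bt => a _; exact: H.
      by rewrite (bigD1 a)//= (BP a).2 indicE memNset// mul0r.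
    over.
  rewrite integral_indic//; last first.
    apply: fin_bigcap_measurable => // a _.
    by rewrite -[_ @^-1` _]setTI; apply: mY => //; exact: (BP a).1.
  rewrite setIT box; last by move=> a; exact: (BP a).1.
  apply: eq_bigr => a _; rewrite (BP a).2 integral_indic ?setIT//.
  exact: (BP a).1.
pose w t := \prod_(b | b != a) f b (Y b t).
have mw : measurable_fun setT w.
  have -> : w = fun t => \prod_b (if b != a then f b (Y b t) else 1).
    by apply/funext => t; rewrite /w big_mkcond.
  apply: measurable_prod => b _; case: (b != a) => //.
  exact: measurableT_comp.
have w0 t : 0 <= w t by apply: prodr_ge0.
pose c := (\prod_(b | b != a) \int[gamma]_u (f b u)%:E)%E.
(* By induction, the law of [Y a] weighted by [w] is c times [gamma]. *)
have intI B : measurable B ->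
    (\int[P]_t (\1_B (Y a t) * w t)%:E = gamma B * c)%E.
  move=> mB.
  pose f' b := if b == a then \1_B else f b.
  have f'a : f' a = \1_B by rewrite /f' eqxx.
  have f'b b : b != a -> f' b = f b by rewrite /f' => /negbTE ->.
  transitivity (\int[P]_t (\prod_b f' b (Y b t))%:E)%E.
    apply: eq_integral => t _; rewrite (bigD1 a)//= f'a; congr (_ * _)%:E.
    by apply: eq_bigr => b ba; rewrite f'b.
  rewrite IH.
  - rewrite (bigD1 a)//= f'a integral_indic// setIT; congr (_ * _)%E.
    by apply: eq_bigr => b ba; rewrite f'b.
  - by move=> b; rewrite /f'; case: ifP.
  - by move=> b u; rewrite /f'; case: ifP.
  - move=> b; rewrite /f'; case: ifP => // _.
    by rewrite integral_indic// setIT (le_lt_trans (probability_le1 _ _))// ltry.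
  - move=> b bs; rewrite /f'; case: eqVneq => [_|ba]; first by exists B.
    by apply: find; rewrite inE negb_or ba.
have c0 : (0 <= c)%E.
  by apply: prode_ge0 => b _; apply: integral_ge0 => u _; rewrite lee_fin.
have cfin : c \is a fin_num.
  apply: prode_fin_num => b _; rewrite ge0_fin_numE//.
  by apply: integral_ge0 => u _; rewrite lee_fin.
have E : (\int[P]_t (f a (Y a t) * w t)%:E =
    \int[gamma]_u (f a (idfun u) * cst (fine c) u)%:E)%E.
  apply: eq_integral_weighted_comp => //.
  - by move=> _ B mB; rewrite setTI.
  - by move=> u /=; rewrite fine_ge0.
  - move=> B mB; rewrite intI//=.
    under eq_integral => u _ do rewrite EFinM.
    rewrite ge0_integralZr//=.
    + by rewrite integral_indic// setIT fineK.
    + by apply/measurable_EFinP; exact: measurable_indic.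
    + by rewrite lee_fin fine_ge0.
under eq_integral => t _ do rewrite (bigD1 a)//=.
rewrite [RHS](bigD1 a)//= -/c -/(w _) E /=.
under eq_integral => u _ do rewrite EFinM.
rewrite ge0_integralZr//=.
- by rewrite fineK.
- exact/measurable_EFinP.
- by move=> u _; rewrite lee_fin.
- by rewrite lee_fin fine_ge0.
Qed.

Lemma normal_mgf {R : realType} (c : R) :
  (\int[normal_prob 0 1]_u (expR (c * u))%:E = (expR (c ^+ 2 / 2))%:E)%E.
Proof.
have E : (\int[normal_prob (0:R) 1]_u (expR (c * idfun u) * cst (1:R) u)%:E =
    \int[lebesgue_measure]_u (expR (c * idfun u) * normal_pdf (0:R) 1 u)%:E)%E.
  have mid : measurable_fun setT (@idfun R) by move=> _ B mB; rewrite setTI.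
  refine (@eq_integral_weighted_comp R _ _ _ (measurableTypeR R) (measurableTypeR R) R
    (normal_prob (0:R) 1) (@lebesgue_measure R) idfun idfun (cst 1) (normal_pdf (0:R) 1)
    (fun u => expR (c * u)) mid _ _ mid _ _ _ _ _) => //.
  - exact: measurable_normal_pdf.
  - exact: normal_pdf_ge0.
  - move=> B mB /=.
    under eq_integral do rewrite mulr1.
    rewrite integral_indic// setIT.
    transitivity (\int[lebesgue_measure]_(u in B) (normal_pdf (0:R) 1 u)%:E)%E => //.
    rewrite [LHS]integral_mkcond; apply: eq_integral => u _.
    by rewrite patchE indicE; case: ifP => _; rewrite ?mul1r ?mul0r.
  - by apply: measurableT_comp => //; exact: measurable_funM.
transitivity (\int[normal_prob (0:R) 1]_u (expR (c * idfun u) * cst (1:R) u)%:E)%E.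
  by apply: eq_integral => u _; rewrite /= mulr1.
rewrite [LHS]E.
(* Completing the square shifts the mean of the density to [c]. *)
transitivity (\int[lebesgue_measure]_u ((expR (c ^+ 2 / 2))%:E * (normal_pdf c 1 u)%:E))%E.
  apply: eq_integral => u _ /=; rewrite -EFinM; congr (_%:E).
  rewrite !normal_pdfE ?oner_neq0// /normal_fun mulrCA [RHS]mulrCA -!expRD.
  by congr (_ * expR _); rewrite expr1n; field.
rewrite ge0_integralZl_EFin ?expR_ge0//.
- by rewrite integral_normal_pdf mule1.
- by move=> u _; rewrite lee_fin normal_pdf_ge0.
- by apply/measurable_EFinP; exact: measurable_normal_pdf.
Qed.

(** Box probabilities are exactly the input of [integral_prod_comp]; the n p entries of the design
    will form one such family. *)
Definition gaussian_family {R : realType} {d : measure_display}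
    {T : measurableType d} (P : probability T R) {I : finType}
    (Y : I -> T -> R) : Prop :=
  (forall a, measurable_fun setT (Y a)) /\
  forall B : I -> set R, (forall a, measurable (B a)) ->
    P (\bigcap_a (Y a @^-1` B a)) = (\prod_a normal_prob (0 : R) 1 (B a))%E.

Lemma gaussian_mgf {R : realType} {d : measure_display}
    {T : measurableType d} (P : probability T R) {I : finType}
    (Y : I -> T -> R) (c : I -> R) : gaussian_family P Y ->
  (\int[P]_t (expR (\sum_a c a * Y a t))%:E =
   (expR ((\sum_a c a ^+ 2) / 2))%:E)%E.
Proof.
move=> [mY box].
under eq_integral do rewrite expR_sum.
rewrite (integral_prod_comp (gamma := normal_prob (0 : R) 1) mY box (f := fun a u => expR (c a * u))).
- under eq_bigr do rewrite normal_mgf.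
  by rewrite prodEFin -expR_sum mulr_suml.
- by move=> a; apply: measurableT_comp => //; exact: measurable_funM.
- by move=> a u; exact: expR_ge0.
- by move=> a; rewrite normal_mgf ltry.
Qed.

Lemma gaussian_upper_tail {R : realType} {d : measure_display}
    {T : measurableType d} (P : probability T R) {I : finType}
    (Y : I -> T -> R) (c : I -> R) (t : R) : gaussian_family P Y ->
  0 < t -> \sum_a c a ^+ 2 <= 1 ->
  (P [set w | (t <= \sum_a c a * Y a w)%R] <= (expR (- (t ^+ 2 / 2)))%:E)%E.
Proof.
move=> gY t0 c1.
have mS : measurable_fun setT (fun w => \sum_a c a * Y a w).
  by apply: measurable_sum => a; apply: measurable_funM => //; exact: gY.1.
have mE : measurable [set w | t <= \sum_a c a * Y a w].
  rewrite -[X in measurable X]setTI.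
  by apply: (measurable_fun_le measurableT (measurable_cst t) mS).
rewrite -(setIT [set _ | _]) -integral_indic//.
(* Chernoff bound with parameter t, optimal for unit coefficients. *)
apply: (@le_trans _ _ (\int[P]_w ((expR (- t ^+ 2))%:E * (expR (\sum_a (t * c a) * Y a w))%:E))%E).
  apply: ge0_le_integral => //.
  - by apply/measurable_EFinP; exact: measurable_indic.
  - apply: measurable_funeM; apply/measurable_EFinP; apply: measurableT_comp => //.
    by apply: measurable_sum => a; apply: measurable_funM => //; exact: gY.1.
  - move=> w _; rewrite -EFinM lee_fin indicE.
    case: (boolP (w \in _)) => [|_]; last by rewrite mulr_ge0 ?expR_ge0.
    rewrite inE /= => tw; rewrite -expRD -expR0 ler_expR.
    under eq_bigr do rewrite -mulrA.
    by rewrite -mulr_sumr addrC subr_ge0 expr2 ler_wpM2l// ltW.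
rewrite ge0_integralZl_EFin ?expR_ge0//.
- rewrite (gaussian_mgf (fun a => t * c a) gY) -EFinM lee_fin -expRD ler_expR.
  under eq_bigr do rewrite exprMn.
  rewrite -mulr_sumr; have := sqr_ge0 t; nra.
- apply/measurable_EFinP; apply: measurableT_comp => //.
  by apply: measurable_sum => a; apply: measurable_funM => //; exact: gY.1.
Qed.

(** Rotation invariance at the level of exponential moments: orthonormal rows give the combined form
    a squared coefficient norm equal to that of [s]. *)
Lemma gaussian_orthonormal_mgf {R : realType} {d : measure_display}
    {T : measurableType d} (P : probability T R) {I J : finType}
    (Y : I -> T -> R) (L : J -> I -> R) (s : J -> R) : gaussian_family P Y ->
  (forall b b', \sum_a L b a * L b' a = (b == b')%:R) ->
  (\int[P]_t (expR (\sum_b s b * \sum_a L b a * Y a t))%:E =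
   (expR ((\sum_b s b ^+ 2) / 2))%:E)%E.
Proof.
move=> gY LL.
under eq_integral => t _.
  have -> : \sum_b s b * (\sum_a L b a * Y a t) =
      \sum_a (\sum_b s b * L b a) * Y a t.
    under eq_bigr do rewrite mulr_sumr.
    rewrite exchange_big/=; apply: eq_bigr => a _; rewrite mulr_suml.
    by apply: eq_bigr => b _; rewrite mulrA.
  over.
rewrite (gaussian_mgf _ gY); congr (expR (_ / 2))%:E.
under eq_bigr => a _.
  rewrite expr2 mulr_suml; under eq_bigr do rewrite mulr_sumr; over.
rewrite exchange_big/=; apply: eq_bigr => b _; rewrite exchange_big/=.
transitivity (\sum_b' s b * s b' * (b == b')%:R).
  apply: eq_bigr => b' _; rewrite -LL mulr_sumr; apply: eq_bigr => a _; ring.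
rewrite (bigD1 b)//= eqxx mulr1 big1 ?addr0 ?expr2// => b' bb'.
by rewrite eq_sym (negbTE bb') mulr0.
Qed.

(** The sharp constant is 1/2; with 2, the bound exp(x) >= 1 + x suffices. For y >= 1/2 use y <= 2
    y^2; below, cosh y = 1 + (e^(y/2) - e^(-y/2))^2 / 2. *)
Lemma cosh_le_expR {R : realType} (y : R) :
  (expR y + expR (- y)) / 2 <= expR (2 * y ^+ 2).
Proof.
wlog y0 : y / 0 <= y.
  move=> H; have [/H//|/ltW y0] := leP 0 y.
  by have := H (- y); rewrite sqrrN opprK addrC; apply; rewrite oppr_ge0.
have [y2|/ltW y2] := leP (1 / 2) y.
  have h1 : expR y <= expR (2 * y ^+ 2) by rewrite ler_expR; nra.
  have h2 : expR (- y) <= expR (2 * y ^+ 2) by rewrite ler_expR; nra.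
  lra.
apply: (@le_trans _ _ (1 + 2 * y ^+ 2)); last exact: expR_ge1Dx.
have -> : y = y / 2 + y / 2 by lra.
rewrite opprD !expRD; set a := y / 2.
have := expR_ge1Dx (- a); have : expR (- a) <= 1 by rewrite -expR0 ler_expR /a; lra.
have : expR a * expR (- a) = 1 by rewrite -expRD subrr expR0.
have := expR_gt0 a; have := expR_gt0 (- a).
set e := expR a; set z := expR (- a) => z0 e0 ez z1 za.
have a4 : 0 <= a <= 1 / 4 by rewrite /a; lra.
have e43 : e <= 4 / 3 by nra.
have ez0 : 0 <= e - z by nra.
have h : e - z <= 8 / 3 * a.
  have -> : e - z = e * ((1 - z) * (1 + z)) by transitivity (e - e * z * z); [rewrite ez mul1r|ring].
  have h1 : (1 - z) * (1 + z) <= a * 2 by apply: ler_pM; lra.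
  have h2 : 0 <= (1 - z) * (1 + z) by apply: mulr_ge0; lra.
  by apply: (le_trans (ler_pM (ltW e0) h2 e43 h1)); lra.
have h2 : (e - z) ^+ 2 <= (8 / 3 * a) ^+ 2 by rewrite ler_pXn2r// nnegrE; lra.
have -> : e * e + z * z = (e - z) ^+ 2 + 2 * (e * z) by ring.
rewrite ez; have := sqr_ge0 a; nra.
Qed.

(** Rates 1, -1, 1/2, -1/2 and 0 have explicit Gaussian means; the total is e^(1/2) / 2 - 3 e^(1/8)
    + 7/2, about 0.925. *)
Definition gauss_majorant {R : realType} (x : R) : R :=
  expR x / 4 + expR (- x) / 4 - 3 / 2 * expR (x / 2) - 3 / 2 * expR (- (x / 2))
  + 7 / 2.

(* With c = cosh (x / 2), the majorant is c ^ 2 - 3 c + 3, which is at least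
   1 / c because (c - 1) ^ 3 >= 0. *)
Lemma expR_gauss_le {R : realType} (x : R) :
  expR (- (x ^+ 2 / 2)) <= gauss_majorant x.
Proof.
rewrite /gauss_majorant.
have := cosh_le_expR (x / 2).
have -> : 2 * (x / 2) ^+ 2 = x ^+ 2 / 2 by field.
rewrite (expRN (x ^+ 2 / 2)); have := expR_gt0 (x ^+ 2 / 2); set E := expR (x ^+ 2 / 2).
have -> : expR x = expR (x / 2) ^+ 2 by rewrite expr2 -expRD; congr expR; field.
have -> : expR (- x) = expR (- (x / 2)) ^+ 2 by rewrite expr2 -expRD; congr expR; field.
have : expR (x / 2) * expR (- (x / 2)) = 1 by rewrite -expRD subrr expR0.
have := expR_gt0 (x / 2); have := expR_gt0 (- (x / 2)).
set q := expR (x / 2); set r := expR (- (x / 2)) => r0 q0 qr E0 cE.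
set c := (q + r) / 2 in cE.
have c1 : 1 <= c.
  have : 0 <= (q - r) ^+ 2 := sqr_ge0 _.
  have : (q + r) ^+ 2 = (q - r) ^+ 2 + 4 * (q * r) by ring.
  rewrite qr /c => ? ?; nra.
have -> : q ^+ 2 / 4 + r ^+ 2 / 4 - 3 / 2 * q - 3 / 2 * r + 7 / 2 = c ^+ 2 - 3 * c + 3.
  have -> : c ^+ 2 = (q ^+ 2 + r ^+ 2 + 2 * (q * r)) / 4 by rewrite /c; field.
  by rewrite qr /c; field.
apply: (@le_trans _ _ c^-1); first by rewrite lef_pV2// posrE; lra.
rewrite -[leLHS]mul1r ler_pdivrMr; last by lra.
have : 0 <= (c - 1) ^+ 3 by apply: exprn_ge0; lra.
have -> : (c - 1) ^+ 3 = (c ^+ 2 - 3 * c + 3) * c - 1 by ring.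
lra.
Qed.

Lemma expR_gauss_mean_lt1 {R : realType} :
  expR (1 ^+ 2 / 2) / 2 - 3 * expR ((1 / 2) ^+ 2 / 2) + 7 / 2 <= expR (- (7 / 100)) :> R.
Proof.
have -> : (1 / 2) ^+ 2 / 2 = 1 / 8 :> R by field.
have -> : expR (1 ^+ 2 / 2) = expR (1 / 8) ^+ 4 :> R.
  by rewrite -expRM_natl; congr expR; field.
have := expR_ge1Dx (1 / 8 : R).
have : expR (1 / 8) <= 8 / 7 :> R.
  have := expR_ge1Dx (- (1 / 8) : R); have : expR (1 / 8) * expR (- (1 / 8)) = 1 :> R by rewrite -expRD subrr expR0.
  have := expR_gt0 (1 / 8 : R); nra.
have := expR_ge1Dx (- (7 / 100) : R).
set q := expR (1 / 8) => h q1 q2.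
apply: (le_trans _ h).
(* The chord of q^2 over [9/8, 8/7] bounds the quartic by a quadratic. *)
have q3 : (q - 9/8) * (8/7 - q) >= 0 by apply: mulr_ge0; lra.
have q4 : q ^+ 2 <= (9/8 + 8/7) * q - 9/7 by nra.
have q5 : q ^+ 4 <= ((9/8 + 8/7) * q - 9/7) ^+ 2.
  by rewrite (exprM q 2 2) ler_pXn2r// nnegrE ?sqr_ge0//; nra.
nra.
Qed.

(** The product of five-term sums expands into exponentials of linear forms, which are integrated
    one by one and factored back; independence of the rotated variables is never stated. Negative
    coefficients make integrability of each term necessary. *)
Lemma gaussian_prod_majorant {R : realType} {d : measure_display}
    {T : measurableType d} (P : probability T R) {I J : finType}
    (Y : I -> T -> R) (L : J -> I -> R) : gaussian_family P Y ->
  (forall b b', \sum_a L b a * L b' a = (b == b')%:R) ->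
  (\int[P]_t (\prod_b gauss_majorant (\sum_a L b a * Y a t))%:E <=
   (expR (- (7 / 100 * #|J|%:R)))%:E)%E.
Proof.
move=> gY LL.
pose A (k : 'I_5) : R := nth 0 [:: 1/4; 1/4; - (3/2); - (3/2); 7/2] k.
pose S (k : 'I_5) : R := nth 0 [:: 1; - 1; 1/2; - (1/2); 0] k.
have majE x : gauss_majorant x = \sum_k A k * expR (S k * x).
  rewrite !big_ord_recl big_ord0 /A /S /gauss_majorant /=.
  rewrite !mul1r mulN1r mul0r expR0 !mulNr ![2^-1 * x]mulrC.
  by ring.
pose F (f : {ffun J -> 'I_5}) t := expR (\sum_b S (f b) * \sum_a L b a * Y a t).
have FE f : (\int[P]_t (F f t)%:E = (expR ((\sum_b S (f b) ^+ 2) / 2))%:E)%E.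
  exact: (gaussian_orthonormal_mgf _ gY LL).
have mF f : measurable_fun setT (EFin \o F f).
  apply/measurable_EFinP; apply: measurableT_comp => //.
  apply: measurable_sum => b; apply: measurable_funM => //.
  by apply: measurable_sum => a; apply: measurable_funM => //; exact: gY.1.
have iF f : P.-integrable setT (EFin \o F f).
  apply/integrableP; split => //.
  under eq_integral => t _ do rewrite /= ger0_norm ?expR_ge0//.
  by rewrite FE ltry.
under eq_integral => t _.
  have -> : \prod_b gauss_majorant (\sum_a L b a * Y a t) =
      \sum_(f : {ffun J -> 'I_5}) (\prod_b A (f b)) * F f t.
    under eq_bigr do rewrite majE.
    rewrite bigA_distr_bigA; apply: eq_bigr => f _.
    by rewrite big_split/= /F expR_sum.
  rewrite -sumEFin.
  under eq_bigr do rewrite EFinM.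
  over.
rewrite integral_sum//=; last first.
  by move=> f; apply: (@integrableZl _ _ _ P setT measurableT _ (EFin \o F f)).
have -> : (\sum_(f : {ffun J -> 'I_5}) \int[P]_x ((\prod_b A (f b))%:E * (F f x)%:E) =
   (\sum_(f : {ffun J -> 'I_5}) (\prod_b A (f b)) * expR ((\sum_b S (f b) ^+ 2) / 2))%:E)%E.
  rewrite -sumEFin; apply: eq_bigr => f _; rewrite (@integralZl _ _ _ P setT measurableT (EFin \o F f))//.
  by rewrite /= FE EFinM.
rewrite lee_fin.
under eq_bigr => f _.
  rewrite mulr_suml expR_sum -big_split/=; over.
rewrite -(bigA_distr_bigA (fun (_ : J) k => A k * expR (S k ^+ 2 / 2))) prodr_const.
have -> : expR (- (7 / 100 * #|J|%:R)) = expR (- (7 / 100)) ^+ #|J| :> R.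
  by rewrite -mulNr mulrC expRM_natl.
rewrite [X in X ^+ _](_ : _ = expR (1 ^+ 2 / 2) / 2 - 3 * expR ((1 / 2) ^+ 2 / 2) + 7 / 2).
  rewrite lerXn2r ?nnegrE ?expR_ge0//; last exact: expR_gauss_mean_lt1.
  (* Comparing powers also requires a nonnegative base. *)
  have := expR_ge1Dx (1 ^+ 2 / 2 : R); have := @expR_gauss_mean_lt1 R.
  have -> : (1 / 2) ^+ 2 / 2 = 1 / 8 :> R by field.
  have -> : expR (1 ^+ 2 / 2) = expR (1 / 8) ^+ 4 :> R.
    by rewrite -expRM_natl; congr expR; field.
  have := expR_ge1Dx (1 / 8 : R); set q := expR _ => *.
  have : 0 <= (q ^+ 2 - 3 / 2) ^+ 2 := sqr_ge0 _.
  have : 0 <= (q - 6 / 5) ^+ 2 := sqr_ge0 _.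
  nra.
rewrite !big_ord_recl big_ord0 /A /S /=.
by rewrite !sqrrN expr0n/= mul0r expR0; field.
Qed.

(** Markov's inequality for exp(- sum / 2) loses |J| / 32 on the event, and 7/100 is more than
    2/32. *)
Lemma gaussian_lower_tail {R : realType} {d : measure_display}
    {T : measurableType d} (P : probability T R) {I J : finType}
    (Y : I -> T -> R) (L : J -> I -> R) : gaussian_family P Y ->
  (forall b b', \sum_a L b a * L b' a = (b == b')%:R) ->
  (P [set w | (\sum_b (\sum_a L b a * Y a w) ^+ 2 <= #|J|%:R / 16)%R] <=
   (expR (- (#|J|%:R / 32)))%:E)%E.
Proof.
move=> gY LL.
pose x b w := \sum_a L b a * Y a w.
have mx b : measurable_fun setT (x b).
  by apply: measurable_sum => a; apply: measurable_funM => //; exact: gY.1.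
set E := [set w | _].
have mE : measurable E.
  rewrite -[X in measurable X]setTI.
  apply: (measurable_fun_le measurableT) => //.
  by apply: measurable_sum => b; apply: measurable_funX; exact: mx.
have mG : measurable_fun setT (fun w => \prod_b gauss_majorant (x b w)).
  apply: measurable_prod => b _; rewrite /gauss_majorant.
  have mexp (c : R) : measurable_fun setT (fun w => expR (x b w * c)).
    by apply: measurableT_comp => //; apply: measurable_funM => //; exact: mx.
  have mexpN (c : R) : measurable_fun setT (fun w => expR (- (x b w * c))).
    by under eq_fun do rewrite -mulrN; exact: mexp.
  have mexp1 : measurable_fun setT (fun w => expR (x b w)).
    by under eq_fun do rewrite -(mulr1 (x b _)); exact: mexp.
  have mexpN1 : measurable_fun setT (fun w => expR (- x b w)).
    by under eq_fun do rewrite -(mulr1 (x b _)); exact: mexpN.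
  do ?[apply: measurable_funD|apply: measurable_funB|apply: measurable_funM] => //.
    by under eq_fun do rewrite -mulNr; apply: measurable_funM.
  by under eq_fun do rewrite -mulNr; apply: measurable_funM.
have G0 w : 0 <= \prod_b gauss_majorant (x b w).
  by apply: prodr_ge0 => b _; apply: le_trans (expR_gauss_le _); exact: expR_ge0.
rewrite -(setIT E) -integral_indic//.
apply: (@le_trans _ _ (\int[P]_w ((expR (#|J|%:R / 32))%:E * (\prod_b gauss_majorant (x b w))%:E))%E).
  apply: ge0_le_integral => //.
  - by apply/measurable_EFinP; exact: measurable_indic.
  - by apply: measurable_funeM; apply/measurable_EFinP.
  - move=> w _; rewrite -EFinM lee_fin indicE.
    case: (boolP (w \in _)) => [|_]; last by rewrite mulr_ge0 ?expR_ge0.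
    rewrite inE /E /= => Ew.
    apply: (@le_trans _ _ (expR (#|J|%:R / 32) * expR (\sum_b - (x b w ^+ 2 / 2)))).
      have Ew' : \sum_b x b w ^+ 2 <= #|J|%:R / 16 := Ew.
      rewrite -expRD -[leLHS]expR0 ler_expR sumrN -mulr_suml; lra.
    rewrite ler_wpM2l ?expR_ge0// expR_sum; apply: ler_prod => b _.
    by rewrite expR_ge0/=; exact: expR_gauss_le.
rewrite ge0_integralZl_EFin ?expR_ge0//.
- apply: (@le_trans _ _ ((expR (#|J|%:R / 32))%:E * (expR (- (7 / 100 * #|J|%:R)))%:E)%E).
    by rewrite lee_wpmul2l ?lee_fin ?expR_ge0//; exact: gaussian_prod_majorant.
  rewrite -EFinM lee_fin -expRD ler_expR.
  have : 0 <= #|J|%:R :> R by [].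
  lra.
- by move=> w _; rewrite lee_fin.
- exact/measurable_EFinP.
Qed.

Lemma iid_gaussian_family {R : realType} {d : measure_display}
    {T : measurableType d} (P : probability T R) {n p : nat}
    (X : 'I_n -> {RV P >-> p.-tuple R}) : iid_std_gaussian X ->
  gaussian_family P (fun (a : 'I_n * 'I_p) w => tnth (X a.1 w) a.2).
Proof.
move=> [ind std]; split.
  move=> a; apply: (measurableT_comp (measurable_tnth a.2)); exact: measurable_funP.
move=> B mB.
pose C i := [set x : p.-tuple R | forall j, B (i, j) (tnth x j)].
have CE i : C i = \bigcap_j ((fun x : p.-tuple R => tnth x j) @^-1` B (i, j)).
  by apply/seteqP; split => x /= Cx; [move=> j _; exact: Cx|move=> j; exact: Cx].
have mC i : measurable (C i).
  rewrite CE; apply: fin_bigcap_measurable => // j _.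
  by rewrite -[_ @^-1` _]setTI; apply: measurable_tnth.
have := ind [set: 'I_n]%SET C mC.
have -> : \bigcap_(i in [set` [set: 'I_n]%SET]) X i @^-1` C i =
    \bigcap_a (fun w => tnth (X a.1 w) a.2) @^-1` B a.
  apply/seteqP; split => w /= H.
    by move=> [i j] _ /=; apply: (H i); rewrite /= inE.
  by move=> i _ j; exact: (H (i, j)).
move=> ->.
transitivity (\prod_(i < n) \prod_(j < p) normal_prob (0 : R) 1 (B (i, j)))%E.
  rewrite (eq_bigl predT) => [|i]; last by rewrite finset.in_setT.
  by apply: eq_bigr => i _; exact: (std i (fun j => B (i, j))).
by rewrite pair_big/=; apply: eq_bigr => -[].
Qed.

(** * High-probability events *)

(* [good] need not be measurable: only the exceptional set is. *)
Definition holds_except {R : realType} {d : measure_display}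
    {T : measurableType d} (P : probability T R) (e : R) (good : T -> Prop) : Prop :=
  exists B : set T, [/\ measurable B, (P B <= e%:E)%E & forall w, ~ B w -> good w].

Section HoldsExcept.
Context {R : realType} {d : measure_display} {T : measurableType d}.
Variable P : probability T R.

Lemma holds_exceptS (e e' : R) (good good' : T -> Prop) : e <= e' ->
  (forall w, good w -> good' w) -> holds_except P e good -> holds_except P e' good'.
Proof.
move=> ee gg [B [mB PB Bg]]; exists B; split => //.
  by apply: (le_trans PB); rewrite lee_fin.
by move=> w /Bg/gg.
Qed.

Lemma holds_except_and (e1 e2 : R) (good1 good2 : T -> Prop) :
  holds_except P e1 good1 -> holds_except P e2 good2 ->
  holds_except P (e1 + e2) (fun w => good1 w /\ good2 w).
Proof.
move=> [B1 [mB1 PB1 Bg1]] [B2 [mB2 PB2 Bg2]]; exists (B1 `|` B2); split.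
- exact: measurableU.
- by apply: (le_trans (measureU2 _ mB1 mB2)); rewrite EFinD; exact: leeD.
- by move=> w /not_orP[/Bg1 ? /Bg2 ?].
Qed.

Lemma holds_except_all {K : eqType} (s : seq K) (e : R) (good : K -> T -> Prop) :
  (forall k, k \in s -> holds_except P e (good k)) ->
  holds_except P ((size s)%:R * e) (fun w => forall k, k \in s -> good k w).
Proof.
elim: s => [_|k s IH H].
  by exists set0; split => //; rewrite measure0 mul0r.
have Hk := H k (mem_head _ _).
have Hs := IH (fun k' ks => H k' (mem_behead (s := k :: s) ks)).
apply: holds_exceptS (holds_except_and Hk Hs).
  by rewrite /= -natr1 mulrDl mul1r addrC.
by move=> w [gk gs] k'; rewrite inE => /predU1P[->|/gs].
Qed.

Context {n p : nat}.
Variable X : 'I_n -> {RV P >-> p.-tuple R}.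
Hypothesis gY : gaussian_family P (fun (a : 'I_n * 'I_p) w => tnth (X a.1 w) a.2).
Let x w i := row_of_tuple (X i w).

Let Y (a : 'I_n * 'I_p) w := tnth (X a.1 w) a.2.

Let dot_appE u v w : dot (design_app (x w) u) v = \sum_a (v ord0 a.1 * u ord0 a.2) * Y a w.
Proof.
rewrite -(pair_bigA _ (fun i j => (v ord0 i * u ord0 j) * Y (i, j) w))/=.
apply: eq_bigr => i _; rewrite mxE mulr_suml; apply: eq_bigr => j _.
by rewrite /x !mxE /Y/=; ring.
Qed.

Let sum_sqr_tensor (u : 'rV[R]_p) (v : 'rV[R]_n) :
  \sum_(a : 'I_n * 'I_p) (v ord0 a.1 * u ord0 a.2) ^+ 2 = dot u u * dot v v.
Proof.
rewrite -(pair_bigA _ (fun i j => (v ord0 i * u ord0 j) ^+ 2))/=.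
rewrite mulrC mulr_suml; apply: eq_bigr => i _; rewrite mulr_sumr.
by apply: eq_bigr => j _; ring.
Qed.

Let mtensor u v : measurable_fun setT (fun w => dot (design_app (x w) u) v).
Proof.
under eq_fun do rewrite dot_appE.
by apply: measurable_sum => a; apply: measurable_funM => //; exact: gY.1.
Qed.

Let mapp u i : measurable_fun setT (fun w => design_app (x w) u ord0 i).
Proof.
have -> : (fun w => design_app (x w) u ord0 i) =
    fun w => dot (design_app (x w) u) (delta_mx ord0 i).
  apply/funext => w; rewrite /dot (bigD1 i)//= [X in _ + X]big1 ?addr0.
    by rewrite mxE [X in _ * X]mxE !eqxx mulr1.
  by move=> k /negbTE ki; rewrite [X in _ * X]mxE ki andbF mulr0.
exact: mtensor.
Qed.

Let madj v j : measurable_fun setT (fun w => design_adj (x w) v ord0 j).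
Proof.
have -> : (fun w => design_adj (x w) v ord0 j) =
    fun w => dot (design_app (x w) (delta_mx ord0 j)) v.
  apply/funext => w; rewrite dot_design /dot (bigD1 j)//= [X in _ + X]big1 ?addr0.
    by rewrite [X in X * _]mxE !eqxx mul1r.
  by move=> k /negbTE kj; rewrite [X in X * _]mxE kj andbF mul0r.
exact: mtensor.
Qed.

Lemma holds_except_bilinear (t : R) u v : 0 < t -> norm2 u <= 1 -> norm2 v <= 1 ->
  holds_except P (expR (- (t ^+ 2 / 2))) (fun w => dot (design_app (x w) u) v <= t).
Proof.
move=> t0 u1 v1.
exists [set w | t <= dot (design_app (x w) u) v]; split.
- rewrite -[X in measurable X]setTI.
  by apply: (measurable_fun_le measurableT (measurable_cst t)); exact: mtensor.
- have -> : [set w | t <= dot (design_app (x w) u) v] =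
      [set w | t <= \sum_a (v ord0 a.1 * u ord0 a.2) * Y a w].
    by apply/funext => w; rewrite /= dot_appE.
  apply: (gaussian_upper_tail gY) => //.
  rewrite sum_sqr_tensor -!sqr_norm2 mulr_ile1 ?sqr_ge0//.
    by rewrite expr_le1 ?norm2_ge0.
  by rewrite expr_le1 ?norm2_ge0.
- by move=> w /negP; rewrite -ltNge => /ltW.
Qed.

Lemma holds_except_app_lower u :
  holds_except P (expR (- (n%:R / 32)))
    (fun w => n%:R / 16 * dot u u <= dot (design_app (x w) u) (design_app (x w) u)).
Proof.
have [->|u0] := eqVneq u 0.
  exists set0; split => //; first by rewrite measure0 lee_fin expR_ge0.
  by move=> w _; rewrite dot0l mulr0 dot_ge0.
have uu0 : 0 < norm2 u by rewrite lt_def norm2_ge0 andbT; apply: contra_neq u0; exact: norm2_eq0.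
(* The orthonormal rows e_i tensor u / |u| produce the coordinates of X u / |u|. *)
pose L (i : 'I_n) (a : 'I_n * 'I_p) : R := (a.1 == i)%:R * (u ord0 a.2 / norm2 u).
have LE i w : \sum_a L i a * Y a w = (norm2 u)^-1 * design_app (x w) u ord0 i.
  rewrite -(pair_bigA _ (fun k j => L i (k, j) * Y (k, j) w))/= (bigD1 i)//=.
  rewrite [X in _ + X]big1 ?addr0; last first.
    by move=> k ki; rewrite big1// => j _; rewrite /L /= (negbTE ki) !mul0r.
  rewrite mxE mulr_sumr; apply: eq_bigr => j _.
  by rewrite /L /= eqxx /x /Y mxE/=; ring.
have LL i i' : \sum_a L i a * L i' a = (i == i')%:R.
  rewrite -(pair_bigA _ (fun k j => L i (k, j) * L i' (k, j)))/= (bigD1 i)//=.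
  rewrite [X in _ + X]big1 ?addr0; last first.
    by move=> k ki; rewrite big1// => j _; rewrite /L /= (negbTE ki) !mul0r.
  rewrite /L /=; case: (eqVneq i i') => _; last by rewrite big1// => j _; rewrite mul0r mulr0.
  under eq_bigr do rewrite eqxx !mul1r mulrACA -invfM.
  by rewrite -mulr_suml -expr2 sqr_norm2 -/(dot u u) mulfV// -sqr_norm2 sqrf_eq0 gt_eqF.
have low := gaussian_lower_tail gY LL; rewrite card_ord in low.
exists [set w | \sum_i (\sum_a L i a * Y a w) ^+ 2 <= n%:R / 16]; split => //.
  rewrite -[X in measurable X]setTI.
  apply: (measurable_fun_le measurableT _ (measurable_cst _)).
  apply: measurable_sum => i; apply: measurable_funX.
  by apply: measurable_sum => a; apply: measurable_funM => //; exact: gY.1.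
move=> w /negP; rewrite -ltNge => /ltW.
under eq_bigr do rewrite LE exprMn.
rewrite -mulr_sumr exprVn [_^-1 * _]mulrC ler_pdivlMr ?exprn_gt0// sqr_norm2 => h.
by apply: (le_trans h); rewrite le_eqVlt; apply/orP; left; apply/eqP; apply: eq_bigr => i _; rewrite expr2.
Qed.

Lemma holds_except_adj_lower v :
  holds_except P (expR (- (p%:R / 32)))
    (fun w => p%:R / 16 * dot v v <= dot (design_adj (x w) v) (design_adj (x w) v)).
Proof.
have [->|v0] := eqVneq v 0.
  exists set0; split => //; first by rewrite measure0 lee_fin expR_ge0.
  by move=> w _; rewrite dot0l mulr0 dot_ge0.
have vv0 : 0 < norm2 v by rewrite lt_def norm2_ge0 andbT; apply: contra_neq v0; exact: norm2_eq0.
(* Now the rows are v / |v| tensor e_j; there are p of them, hence p degrees of freedom. *)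
pose L (j : 'I_p) (a : 'I_n * 'I_p) : R := (a.2 == j)%:R * (v ord0 a.1 / norm2 v).
have LE j w : \sum_a L j a * Y a w = (norm2 v)^-1 * design_adj (x w) v ord0 j.
  rewrite -(pair_bigA _ (fun i k => L j (i, k) * Y (i, k) w))/= mxE mulr_sumr.
  apply: eq_bigr => i _; rewrite (bigD1 j)//= [X in _ + X]big1 ?addr0; last first.
    by move=> k ki; rewrite /L /= (negbTE ki) !mul0r.
  by rewrite /L /= eqxx /x /Y mxE/=; ring.
have LL j j' : \sum_a L j a * L j' a = (j == j')%:R.
  rewrite -(pair_bigA _ (fun i k => L j (i, k) * L j' (i, k)))/=.
  under eq_bigr => i _.
    rewrite (bigD1 j)//= [X in _ + X]big1 ?addr0; last first.
      by move=> k ki; rewrite /L /= (negbTE ki) !mul0r.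
    over.
  rewrite /L /=; case: (eqVneq j j') => _; last by rewrite big1// => i _; rewrite mul0r mulr0.
  under eq_bigr do rewrite eqxx !mul1r mulrACA -invfM.
  by rewrite -mulr_suml -expr2 sqr_norm2 -/(dot v v) mulfV// -sqr_norm2 sqrf_eq0 gt_eqF.
have low := gaussian_lower_tail gY LL; rewrite card_ord in low.
exists [set w | \sum_j (\sum_a L j a * Y a w) ^+ 2 <= p%:R / 16]; split => //.
  rewrite -[X in measurable X]setTI.
  apply: (measurable_fun_le measurableT _ (measurable_cst _)).
  apply: measurable_sum => j; apply: measurable_funX.
  by apply: measurable_sum => a; apply: measurable_funM => //; exact: gY.1.
move=> w /negP; rewrite -ltNge => /ltW.
under eq_bigr do rewrite LE exprMn.
rewrite -mulr_sumr exprVn [_^-1 * _]mulrC ler_pdivlMr ?exprn_gt0// sqr_norm2 => h.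
by apply: (le_trans h); rewrite le_eqVlt; apply/orP; left; apply/eqP; apply: eq_bigr => i _; rewrite expr2.
Qed.

End HoldsExcept.

Lemma exprn_le_expR {R : realType} (a c : R) (k : nat) : 0 <= a -> a <= expR c ->
  a ^+ k <= expR (c * k%:R).
Proof.
by move=> a0 ac; rewrite mulrC expRM_natl; apply: lerXn2r; rewrite ?nnegrE ?expR_ge0.
Qed.

(** 2.56 is below (9/8)^8 <= e, which reduces comparisons of numerals with powers of e to rational
    arithmetic. *)
Lemma expR_nat_ge {R : realType} (k : nat) : (64 / 25) ^+ k <= expR k%:R :> R.
Proof.
rewrite -[k%:R]mul1r; apply: exprn_le_expR; first by rewrite divr_ge0.
have -> : 1 = 1 / 8 * 8%:R :> R by field.
apply: le_trans (exprn_le_expR 8 _ (expR_ge1Dx _)); last by lra.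
by rewrite !exprS expr0; lra.
Qed.

(** * Union bounds for the Gaussian design *)

Section Events.
Context {R : realType} {d : measure_display} {T : measurableType d}.
Variable P : probability T R.
Context {n p : nat}.
Variable X : 'I_n -> {RV P >-> p.-tuple R}.
Hypothesis gY : gaussian_family P (fun (a : 'I_n * 'I_p) w => tnth (X a.1 w) a.2).
Let x w i := row_of_tuple (X i w).

Lemma holds_except_op (S : {set 'I_p}) (t : R) : 0 < t ->
  holds_except P (48 ^+ (#|S| + n) * expR (- (t ^+ 2 / 2))) (fun w =>
    forall th, proj_on S th = th -> norm2 (design_app (x w) th) <= 2 * t * norm2 th).
Proof.
move=> t0; have q4 : 0 < (1 / 4 : R) <= 1 by lra.
have [N1 [sN1 N1S N1c]] := ball_net S q4.
have [N2 [sN2 N2S N2c]] := ball_net [set: 'I_n]%SET q4.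
have := @holds_except_all _ _ _ P _ [seq (u, v) | u <- N1, v <- N2]
  (expR (- (t ^+ 2 / 2))) (fun k w => dot (design_app (x w) k.1) k.2 <= t).
move=> H; apply: holds_exceptS (H _).
- rewrite ler_wpM2r ?expR_ge0// size_allpairs natrM exprD.
  have e48 : 12 / (1 / 4) = 48 :> R by field.
  by rewrite e48 ?cardsT ?card_ord in sN1 sN2; apply: ler_pM.
- move=> w tN; apply: (@op_bound_of_net _ _ _ _ _ _ N1 N2) => // u v uN vN.
  by apply: (tN (u, v)); apply: allpairs_f.
- move=> [u v] /allpairsP[[u' v'] /= [uN vN [-> ->]]].
  by apply: (holds_except_bilinear gY) => //; [have [] := N1S u' uN|have [] := N2S v' vN].
Qed.

Lemma holds_except_net_lower (S : {set 'I_p}) (eps : R) : 0 < eps <= 1 ->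
  holds_except P ((12 / eps) ^+ #|S| * expR (- (n%:R / 32))) (fun w =>
    exists2 N, is_ball_net S eps N & forall u, u \in N ->
      Num.sqrt n%:R / 4 * norm2 u <= norm2 (design_app (x w) u)).
Proof.
move=> e01; have [N [sN NS Nc]] := ball_net S e01.
have H := @holds_except_all _ _ _ P _ N (expR (- (n%:R / 32)))
  (fun u w => n%:R / 16 * dot u u <= dot (design_app (x w) u) (design_app (x w) u)).
apply: holds_exceptS (H _).
- by rewrite ler_wpM2r ?expR_ge0.
- move=> w low; exists N => // u uN.
  rewrite -(ler_pXn2r (ltn0Sn 1)) ?nnegrE ?mulr_ge0 ?norm2_ge0 ?divr_ge0 ?sqrtr_ge0//.
  rewrite exprMn expr_div_n sqr_sqrtr// !sqr_norm2; have := low u uN; lra.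
- by move=> u _; exact: (holds_except_app_lower gY).
Qed.

Lemma holds_except_net_adj_lower (eps : R) : 0 < eps <= 1 ->
  holds_except P ((12 / eps) ^+ n * expR (- (p%:R / 32))) (fun w =>
    exists2 N, is_ball_net [set: 'I_n]%SET eps N & forall v, v \in N ->
      p%:R / 16 * dot v v <= dot (design_adj (x w) v) (design_adj (x w) v)).
Proof.
move=> e01; have [N [sN NS Nc]] := ball_net [set: 'I_n]%SET e01.
have H := @holds_except_all _ _ _ P _ N (expR (- (p%:R / 32)))
  (fun v w => p%:R / 16 * dot v v <= dot (design_adj (x w) v) (design_adj (x w) v)).
apply: holds_exceptS (H _).
- by rewrite ler_wpM2r ?expR_ge0//; move: sN; rewrite cardsT card_ord.
- by move=> w low; exists N.
- by move=> u _; exact: (holds_except_adj_lower gY).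
Qed.

Context {M : nat}.
Variable G : 'I_M -> {set 'I_p}.
Hypotheses (n0 : (0 < n)%N) (M0 : (0 < M)%N) (partG : is_group_partition G)
  (lnM : ln M%:R <= (min_group G)%:R :> R).
Let g := max_group G.
Let m := min_group G.
Let W : R := group_ratio R G.
(** The level 40 gives exp(- 20 (n + g)), which pays for exp(n + g) tuples of groups and nets of
    size exp(5 (2 n + g)), and leaves exp(- 9 n). *)
Let t : R := Num.sqrt (40 * (n + g)%:R).

Let m0 : (0 < m)%N. Proof. exact: min_group_gt0. Qed.
Let mg : (m <= g)%N. Proof. exact: min_group_le_max. Qed.
Let n0R : 0 < n%:R :> R. Proof. by rewrite ltr0n. Qed.
Let m0R : 0 < m%:R :> R. Proof. by rewrite ltr0n. Qed.

Let t0 : 0 < t.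
Proof. by rewrite sqrtr_gt0 mulr_gt0// ltr0n ltn_addr. Qed.
Let tE : t ^+ 2 = 40 * (n + g)%:R.
Proof. by rewrite sqr_sqrtr// mulr_ge0. Qed.

Let tuples_le k : M%:R ^+ k <= expR (k * g)%:R :> R.
Proof.
have -> : M%:R ^+ k = expR (k%:R * ln M%:R) :> R by rewrite expRM_natl lnK// posrE ltr0n.
rewrite ler_expR natrM ler_wpM2l//; apply: (le_trans lnM).
by rewrite ler_nat.
Qed.

(** Shared by the lower isometry and the dual lower bound, both proved conditionally on it. *)
Let op_on_groups k w := forall (s : k.-tuple 'I_M) th, proj_on (group_union G s) th = th ->
  norm2 (design_app (x w) th) <= 2 * t * norm2 th.

Lemma holds_except_op_on_groups k : (k * g <= n + g)%N ->
  holds_except P (expR (- (9 * n%:R))) (op_on_groups k).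
Proof.
move=> kg.
have H := @holds_except_all _ _ _ P _ (enum {: k.-tuple 'I_M})
  (48 ^+ (n + g + n) * expR (- (t ^+ 2 / 2)))
  (fun s w => forall th, proj_on (group_union G s) th = th ->
    norm2 (design_app (x w) th) <= 2 * t * norm2 th).
apply: holds_exceptS (H _).
- rewrite -cardE card_tuple card_ord natrX tE.
  have h48 : 48 ^+ (n + g + n) <= expR (5 * (n + g + n)%:R) :> R.
    apply: exprn_le_expR; first exact: ler0n.
    by apply: le_trans (expR_nat_ge 5); rewrite !exprS expr0; lra.
  have h1 : 48 ^+ (n + g + n) * expR (- (40 * (n + g)%:R / 2)) <=
      expR (5 * (n + g + n)%:R) * expR (- (40 * (n + g)%:R / 2)) :> R.
    by rewrite ler_wpM2r ?expR_ge0.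
  have Mk0 : 0 <= M%:R ^+ k :> R by rewrite exprn_ge0.
  have h0 : 0 <= 48 ^+ (n + g + n) * expR (- (40 * (n + g)%:R / 2)) :> R.
    by apply: mulr_ge0; [exact: exprn_ge0|exact: expR_ge0].
  apply: (le_trans (ler_pM Mk0 h0 (tuples_le k) h1)).
  rewrite -!expRD ler_expR.
  have : (k * g)%:R <= (n + g)%:R :> R by rewrite ler_nat.
  by rewrite !natrD; have : 0 <= g%:R :> R by []; lra.
- by move=> w h s th; apply: h; rewrite mem_enum.
- move=> s _; apply: holds_exceptS (holds_except_op _ t0); last by move=> w; exact.
  rewrite ler_wpM2r ?expR_ge0// ler_weXn2l//; first by lra.
  rewrite leq_add2r; apply: leq_trans kg; apply: (leq_trans (card_group_union G s)).
  by rewrite size_tuple.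
Qed.

Let op_group k w i th : (0 < k)%N -> op_on_groups k w -> proj_on (G i) th = th ->
  norm2 (design_app (x w) th) <= 2 * t * norm2 th.
Proof.
(* A single group is the union of k copies of itself. *)
move=> k0 op thi; apply: (op [tuple of nseq k i]); rewrite -{1}thi.
rewrite proj_on_sub//; apply/fintype.subsetP => j ji; rewrite inE.
by rewrite has_nseq k0.
Qed.

Lemma holds_except_lower_isometry k : (0 < k)%N ->
  ((2 <= k)%N -> (576 * (k * g) <= n)%N) -> (n <= 1152 * (k * g))%N ->
  holds_except P (expR (- (n%:R / 64))) (fun w => op_on_groups k w ->
    forall h, norm2 h ^+ 2 / 64 <= norm2 (design_app (x w) h) ^+ 2 / n%:R
     + (640 * 1152) * (g%:R / n%:R) * gl_norm G h ^+ 2).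
Proof.
move=> k0 kgn nkg.
have gn : n%:R <= 1152 * (k%:R * g%:R) :> R by rewrite -!natrM ler_nat.
have [k2|k1] := ltnP 1 k; last first.
  exists set0; split => //; first by rewrite measure0 lee_fin expR_ge0.
  move=> w _ _ h.
  have kE : k = 1%N by apply/eqP; rewrite eqn_leq k1 k0.
  have h1 : norm2 h ^+ 2 <= gl_norm G h ^+ 2.
    by rewrite lerXn2r ?nnegrE ?norm2_ge0 ?gl_norm_ge0 ?norm2_le_gl_norm.
  have h2 : 1 <= 1152 * (g%:R / n%:R) :> R.
    by rewrite mulrA ler_pdivlMr// mul1r; move: gn; rewrite kE mul1r.
  have h3 : 0 <= norm2 (design_app (x w) h) ^+ 2 / n%:R by rewrite divr_ge0 ?sqr_ge0.
  have := sqr_ge0 (gl_norm G h); nra.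
have {}kgn := kgn k2.
have kgR : 576 * (k%:R * g%:R) <= n%:R :> R by rewrite -!natrM ler_nat.
have gle : g%:R <= n%:R :> R by rewrite ler_nat; move: kgn k2; clear; nia.
(* With a = sqrt n / 4 and B = 18 sqrt n, the mesh 1/150 leaves a (1 - eps) - B eps >= sqrt n / 8.
   The base of the net size is then 12 times 150. *)
have [c cE] : {c : R | c = 1800} by exists 1800.
have c1 : 1 <= c by rewrite cE; lra.
have c8 : c <= expR 8.
  by rewrite cE; apply: le_trans (expR_nat_ge 8); rewrite !exprS expr0; lra.
have e01 : 0 < (1 / 150 : R) <= 1 by lra.
have H := @holds_except_all _ _ _ P _ (enum {: k.-tuple 'I_M})
  (c ^+ (k * g) * expR (- (n%:R / 32)))
  (fun s w => exists2 N, is_ball_net (group_union G s) (1 / 150) N & forall u, u \in N ->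
      Num.sqrt n%:R / 4 * norm2 u <= norm2 (design_app (x w) u)).
apply: holds_exceptS (H _).
- rewrite -cardE card_tuple card_ord natrX.
  have h18 : c ^+ (k * g) <= expR (8 * (k * g)%:R) :> R.
    by apply: exprn_le_expR => //; lra.
  have h1 : c ^+ (k * g) * expR (- (n%:R / 32)) <=
      expR (8 * (k * g)%:R) * expR (- (n%:R / 32)) :> R.
    by rewrite ler_wpM2r ?expR_ge0.
  have Mk0 : 0 <= M%:R ^+ k :> R by rewrite exprn_ge0.
  have h0 : 0 <= c ^+ (k * g) * expR (- (n%:R / 32)) :> R.
    by apply: mulr_ge0; [apply: exprn_ge0; lra|exact: expR_ge0].
  apply: (le_trans (ler_pM Mk0 h0 (tuples_le k) h1)).
  by rewrite -!expRD ler_expR natrM; lra.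
- move=> w low op h.
  have sn0 : 0 < Num.sqrt n%:R :> R by rewrite sqrtr_gt0.
  have snE : Num.sqrt n%:R ^+ 2 = n%:R :> R by rewrite sqr_sqrtr.
  have t2 : 2 * t <= 18 * Num.sqrt n%:R.
    rewrite -(ler_pXn2r (ltn0Sn 1)) ?nnegrE ?mulr_ge0 ?(ltW t0) ?(ltW sn0)//.
    by rewrite !exprMn tE snE natrD; lra.
  have low' (s : k.-tuple 'I_M) th : proj_on (group_union G s) th = th ->
      n%:R / 64 * dot th th <= dot (design_app (x w) th) (design_app (x w) th).
    move=> thS; have [N netN Nlow] := low s (mem_enum _ _).
    have := lower_isometry_of_net netN _ _ (op s) Nlow thS.
    rewrite ?divr_ge0 ?mulr_ge0 ?(ltW t0) ?sqrtr_ge0// => /(_ isT isT) h1.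
    have h2 : Num.sqrt n%:R / 8 * norm2 th <= norm2 (design_app (x w) th).
      by apply: le_trans h1; rewrite ler_wpM2r ?norm2_ge0//; lra.
    move: h2; rewrite -(ler_pXn2r (ltn0Sn 1)) ?nnegrE ?mulr_ge0 ?norm2_ge0 ?divr_ge0 ?sqrtr_ge0//.
    by rewrite exprMn expr_div_n snE !sqr_norm2; lra.
  have up i th : proj_on (G i) th = th ->
      dot (design_app (x w) th) (design_app (x w) th) <= 320 * n%:R * dot th th.
    move=> thi; have := op_group k0 op thi.
    rewrite norm2_le ?mulr_ge0 ?norm2_ge0 ?(ltW t0)// exprMn exprMn tE sqr_norm2.
    by move/le_trans; apply; rewrite ler_wpM2r ?dot_ge0// natrD; lra.
  have c0 : 0 <= n%:R / 64 :> R by rewrite divr_ge0.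
  have b0 : 0 <= 320 * n%:R :> R by lra.
  have := sparse_lower_isometry_extend partG k2 c0 b0 low' up h.
  rewrite -!sqr_norm2; set Q := norm2 (design_app _ _) ^+ 2; set A := gl_norm G h ^+ 2.
  have kR : 0 < k%:R :> R by rewrite ltr0n.
  have A0 : 0 <= A by exact: sqr_ge0.
  (* Here b = 320 n, so 2 b / k is at most 640 times 1152 g, the constant of the remainder. *)
  have kinv : n%:R / k%:R <= 1152 * g%:R :> R.
    by rewrite ler_pdivrMr//; apply: (le_trans gn); rewrite -mulrA [g%:R * _]mulrC.
  move=> main; rewrite -(ler_pM2r n0R) mulrDl divfK ?gt_eqF//.
  have -> : 640 * 1152 * (g%:R / n%:R) * A * n%:R = 640 * (1152 * g%:R * A) by field; rewrite gt_eqF.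
  have : n%:R / k%:R * A <= 1152 * g%:R * A by rewrite ler_wpM2r.
  have E : 2 * (320 * n%:R) / k%:R * A = 640 * (n%:R / k%:R * A) by ring.
  by rewrite E in main; lra.
- move=> s _; apply: holds_exceptS (holds_except_net_lower _ e01); last by move=> w; exact.
  rewrite ler_wpM2r ?expR_ge0//.
  have -> : 12 / (1 / 150) = c :> R by rewrite cE; field.
  rewrite ler_weXn2l//.
  by apply: (leq_trans (card_group_union G s)); rewrite size_tuple.
Qed.

Lemma holds_except_dual_lower k : (0 < k)%N ->
  1184 * n%:R * ln (n%:R + W) <= p%:R ->
  holds_except P (expR (- (9 * n%:R))) (fun w => op_on_groups k w ->
    forall v, exists i, Num.sqrt (min_group G)%:R / 16 * norm2 v
     <= norm2 (proj_on (G i) (design_adj (x w) v))).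
Proof.
move=> k0 pn.
have W1 : 1 <= W by rewrite ler_pdivlMr// mul1r ler_nat.
have n1 : 1 <= n%:R :> R by rewrite ler1n.
have nW : 2 <= n%:R + W by lra.
(* [t2] below bounds the operator norm by 13 sqrt m (n + W), so this mesh costs 13/240 sqrt m
   against the available sqrt m / 4. *)
set eps := (240 * (n%:R + W))^-1.
have eps0 : 0 < eps by rewrite invr_gt0; lra.
have epsE : eps * (240 * (n%:R + W)) = 1 by apply: mulVf; rewrite gt_eqF//; lra.
have eps480 : eps <= 1 / 480 by nra.
have e01 : 0 < eps <= 1 by lra.
have l2 : 1 / 2 <= ln (n%:R + W).
  rewrite -[leLHS]expRK ler_ln ?posrE ?expR_gt0//; last by lra.
  apply: le_trans nW.
  have := expR_ge1Dx (- (1 / 2) : R).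
  have : expR (1 / 2) * expR (- (1 / 2)) = 1 :> R by rewrite -expRD subrr expR0.
  by have := expR_gt0 (1 / 2 : R); nra.
apply: holds_exceptS (holds_except_net_adj_lower e01).
- have -> : 12 / eps = 2880 * (n%:R + W) by rewrite /eps invrK; ring.
  have h : 2880 * (n%:R + W) <= expR (9 + ln (n%:R + W)).
    rewrite expRD lnK ?posrE; last by lra.
    rewrite ler_wpM2r//; first by lra.
    by apply: le_trans (expR_nat_ge 9); rewrite !exprS expr0; lra.
  have hn : (2880 * (n%:R + W)) ^+ n <= expR ((9 + ln (n%:R + W)) * n%:R).
    by apply: exprn_le_expR h; lra.
  apply: (le_trans (ler_wpM2r (expR_ge0 _) hn)).
  (* 1184 is 32 times 37: with l = ln (n + W) >= 1/2, the exponent (9 + l) n - 37 l n is at most - 9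
     n. *)
  rewrite -expRD ler_expR.
  have : n%:R * (1 / 2) <= n%:R * ln (n%:R + W) by rewrite ler_pM2l.
  by rewrite mulrDl [ln _ * _]mulrC; move: pn; rewrite -mulrA; set u := n%:R * ln _ => *; lra.
- move=> w [N netN Nlow] op v.
  have B0 : 0 <= 2 * t by rewrite mulr_ge0 ?(ltW t0).
  have [i hi] := dual_lower_of_net partG M0 netN B0 (fun i th => @op_group k w i th k0 op) Nlow v.
  exists i; apply: le_trans hi; rewrite ler_wpM2r ?norm2_ge0//.
  set sm := Num.sqrt _; have sm0 : 0 <= sm by exact: sqrtr_ge0.
  have smE : sm ^+ 2 = m%:R by rewrite sqr_sqrtr.
  have t2 : 2 * t <= 13 * sm * (n%:R + W).
    have h0 : 0 <= 13 * sm * (n%:R + W) by apply: mulr_ge0; [exact: mulr_ge0|lra].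
    rewrite -(ler_pXn2r (ltn0Sn 1)) ?nnegrE// !exprMn tE smE natrD.
    have gE : g%:R = m%:R * W by rewrite /W /group_ratio mulrC divfK// gt_eqF.
    have m1 : 1 <= m%:R :> R by rewrite ler1n.
    have h1 : n%:R + g%:R <= m%:R * (n%:R + W) by rewrite gE; nra.
    have h2 : m%:R * (n%:R + W) <= m%:R * (n%:R + W) ^+ 2.
      by rewrite ler_wpM2l// expr2 ler_peMl//; lra.
    have h3 : 0 <= m%:R * (n%:R + W) by rewrite mulr_ge0//; lra.
    lra.
  have t3 : 2 * t * eps <= 13 / 240 * sm.
    have -> : 13 / 240 * sm = 13 * sm * (n%:R + W) * eps.
      transitivity (13 / 240 * sm * (eps * (240 * (n%:R + W)))); last by field.
      by rewrite epsE mulr1.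
    by apply: ler_wpM2r t2; exact: ltW.
  have : sm * eps <= sm * (1 / 480) by rewrite ler_wpM2l.
  lra.
Qed.

Lemma holds_except_design : 1184 * n%:R * ln (n%:R + W) <= p%:R ->
  holds_except P (expR (- (128^-1 * n%:R))) (fun w =>
    (forall h, norm2 h ^+ 2 / 64 <= norm2 (design_app (x w) h) ^+ 2 / n%:R
     + (640 * 1152) * (g%:R / n%:R) * gl_norm G h ^+ 2) /\
    (forall v, exists i, Num.sqrt (min_group G)%:R / 16 * norm2 v
     <= norm2 (proj_on (G i) (design_adj (x w) v)))).
Proof.
move=> pn.
have g0 : (0 < g)%N := leq_trans m0 mg.
(* Nets on k groups, hence in dimension at most n / 576, are cheaper than the
   lower tail exp(- n / 32); k = 1 covers groups so large that the restricted
   lower isometry is implied by norm2 h <= gl_norm G h. *)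
pose k := maxn 1 (n %/ (576 * g)).
have k0 : (0 < k)%N by rewrite leq_max.
have dv := leq_trunc_div n (576 * g).
have lt1 : (n < (n %/ (576 * g)).+1 * (576 * g))%N by rewrite ltn_ceil// muln_gt0.
have kE : (n %/ (576 * g) <= 1 /\ k = 1 \/ 1 < n %/ (576 * g) /\ k = n %/ (576 * g))%N.
  by rewrite /k; lia.
have kgn : (2 <= k)%N -> (576 * (k * g) <= n)%N by case: kE => -[h1 h2]; lia.
have nkg : (n <= 1152 * (k * g))%N by case: kE => -[h1 h2]; nia.
have kg : (k * g <= n + g)%N by case: kE => -[h1 h2]; lia.
have H := holds_except_and (holds_except_op_on_groups kg)
  (holds_except_and (holds_except_lower_isometry k0 kgn nkg) (holds_except_dual_lower k0 pn)).
apply: holds_exceptS H; last by move=> w [op [/(_ op) ? /(_ op) ?]].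
have n1 : 1 <= n%:R :> R by rewrite ler1n.
set a := expR (- (n%:R / 64)).
(* The two terms exp(- 9 n) together cost a / 128, absorbed in passing from n / 64 to n / 128. *)
have h8 : expR (- (9 * n%:R)) <= a * (1 / 256).
  apply: (@le_trans _ _ (a * expR (- 8))).
    by rewrite -expRD ler_expR; lra.
  rewrite ler_wpM2l ?expR_ge0// expRN div1r lef_pV2 ?posrE ?expR_gt0//.
  by apply: le_trans (expR_nat_ge 8); rewrite !exprS expr0; lra.
have h128 : a * (1 + n%:R / 128) <= expR (- (128^-1 * n%:R)).
  have -> : expR (- (128^-1 * n%:R)) = a * expR (n%:R / 128).
    by rewrite -expRD; congr expR; field.
  by rewrite ler_wpM2l ?expR_ge0 ?expR_ge1Dx.
have a0 : 0 < a := expR_gt0 _.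
nra.
Qed.

End Events.

Theorem theorem3p4 (R : realType) :
  exists C c0 c0' c1 c2 : R,
    [/\ 0 < C, 0 < c0, 0 < c0', 0 < c1 & 0 < c2] /\
    forall (n p M s : nat) (G : 'I_M -> {set 'I_p}),
      (0 < n)%N -> (0 < M)%N -> is_group_partition G ->
      c0 * n%:R * ln (n%:R + group_ratio R G) <= p%:R ->
      ln M%:R <= c0' * (min_group G)%:R ->
    forall (d : measure_display) (T : measurableType d) (P : probability T R)
      (X : 'I_n -> {RV P >-> p.-tuple R}) (hstar : 'rV[R]_p)
      (xi : T -> 'rV[R]_n),
      iid_std_gaussian X -> group_sparse G s hstar ->
    forall lambda : R, 0 < lambda ->
    exists A : set T,
      [/\ measurable A,
          ((1 - M%:R * expR (- (c1 * n%:R)))%:E <= P A)%E &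
          forall (omega : T) (hhat : 'rV[R]_p), A omega ->
            is_group_lasso G (fun i => row_of_tuple (X i omega))
              (fun i => dot (row_of_tuple (X i omega)) hstar + xi omega ord0 i)
              lambda hhat ->
            norm2 (hhat - hstar) ^+ 2 <=
              C * (group_ratio R G * (norm2 (xi omega) ^+ 2 / n%:R)
                   + gl_norm G hstar ^+ 2 * ((max_group G)%:R / n%:R)
                   + lambda * gl_norm G hstar)
            /\
            (s%:R * (max_group G)%:R <= c2 * n%:R ->
             norm2 (hhat - hstar) ^+ 2 <=
               C * (group_ratio R G * (norm2 (xi omega) ^+ 2 / n%:R)
                    + s%:R * lambda ^+ 2))].
Proof.
pose CE : R := 640 * 1152; have CE0 : 0 < CE by rewrite /CE; lra.
exists (128 * (1024 + 512 * CE)), 1184, 1, (128^-1), (2048 * CE)^-1.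
split; first by split; rewrite ?invr_gt0 /CE; lra.
move=> n p M s G n0 M0 partG pn lnM d T P X hstar xi iid sp lambda l0.
rewrite mul1r in lnM.
have gY := iid_gaussian_family iid.
have [B [mB PB Bgood]] := holds_except_design gY n0 M0 partG lnM pn.
exists (~` B); split.
- exact: measurableC.
- rewrite probability_setC// EFinB leeB//; apply: (le_trans PB).
  by rewrite lee_fin ler_peMl ?expR_ge0// ler1n.
move=> w hhat Bw lasso; have [lowX lowXT] := Bgood w Bw.
have yE i : dot (row_of_tuple (X i w)) hstar + xi w ord0 i =
  dot (row_of_tuple (X i w)) hstar + xi w ord0 i by [].
split.
  exact: (group_lasso_error n0 partG l0 lasso yE M0 CE0 lowX lowXT).
exact: (group_lasso_sparse_error n0 partG l0 lasso yE M0 CE0 lowX lowXT sp).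
Qed.
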